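(* Let $\mathcal{M}$ be an o-minimal expansion of $(\mathbb{R},<)$ and let $(X,\tau)$ be a definable topological space in $\mathcal{M}$. Then $(X,\tau)$ is definably compact if and only if it is compact (in the classical sense that every open cover has a finite subcover; no Hausdorff assumption).
   Context: ''Definable'' means definable in $\mathcal{M}$ with parameters. A definable family of sets is one of the form $\{\varphi(M,b): b\in B\}$ with $\varphi(x,y)$ a formula and $B$ definable; families are taken nonempty. A definable topological space $(X,\tau)$, $X\subseteq M^n$, is a topological space for which some definable family of subsets of $X$ is a basis of $\tau$. Types are complete types over $M$, identified with families of definable sets; $S_X(M)$ is the set of those containing $X$; a type $p(x)$ is definable if for every formula $\varphi(x,y)$ the set $\{b:\varphi(x,b)\in p(x)\}$ is definable. In an o-minimal structure, $(X,\tau)$ is called definably compact if it satisfies any of the following conditions, which are equivalent in that setting (the equivalence may be taken as known): (a) type-compactness: every definable type $p\in S_X(M)$ has a $\tau$-limit, i.e. a point of $X$ lying in every $\tau$-closed set in $p$; (b) filter-compactness: every downward directed definable family of nonempty $\tau$-closed subsets of $X$ has nonempty intersection; (c) transversal-compactness: for every definable family of $\tau$-closed sets all of whose finite subfamilies have nonempty intersection there is a finite set meeting every member of the family. (A family is downward directed if the intersection of any two members contains a member.) *)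

(* Defs.v *)
From HB Require Import structures.
From mathcomp Require Import all_boot all_order all_algebra.
From mathcomp Require Import all_classical reals topology.

Set Implicit Arguments.
Unset Strict Implicit.
Unset Printing Implicit Defensive.

Import Order.TTheory GRing.Theory Num.Theory.
Local Open Scope classical_set_scope.
Local Open Scope ring_scope.

(* The symbols of a first-order language other than [=] and [<], which are
   built into [formula] below: structures for it expand (R, <). *)
Record language := Language {
  fun_symb : Type;
  fun_arity : fun_symb -> nat;
  rel_symb : Type;
  rel_arity : rel_symb -> nat
}.

Inductive term (L : language) : Type :=
| Var of nat
| App (f : fun_symb L) of ('I_(fun_arity f) -> term L).
Arguments Var {L}.
Arguments App {L}.

(* Variables are de Bruijn indices: [Exists phi] binds the variable 0 of
   [phi]. *)
Inductive formula (L : language) : Type :=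
| Equal of term L & term L
| Less of term L & term L
| Rel (r : rel_symb L) of ('I_(rel_arity r) -> term L)
| Not of formula L
| And of formula L & formula L
| Exists of formula L.

Record expansion (L : language) (R : realType) := Expansion {
  fun_interp : forall f : fun_symb L, ('I_(fun_arity f) -> R) -> R;
  rel_interp : forall r : rel_symb L, ('I_(rel_arity r) -> R) -> Prop
}.

Section Definability.
Context {L : language} {R : realType} (M : expansion L R).

Fixpoint eval (v : nat -> R) (t : term L) : R :=
  match t with
  | Var i => v i
  | App f ts => fun_interp M (f := f) (fun i => eval v (ts i))
  end.

Fixpoint sat (v : nat -> R) (phi : formula L) : Prop :=
  match phi with
  | Equal s t => eval v s = eval v t
  | Less s t => eval v s < eval v t
  | Rel r ts => rel_interp M (r := r) (fun i => eval v (ts i))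
  | Not psi => ~ sat v psi
  | And psi chi => sat v psi /\ sat v chi
  | Exists psi => exists a : R, sat (fun i => if i is j.+1 then v j else a) psi
  end.

(* The variables 0, ..., n-1 take the entries of [x]; the remaining ones take
   the parameters [c] (a formula only uses finitely many of them). *)
Definition assignment n (x : 'rV[R]_n) (c : nat -> R) (i : nat) : R :=
  if insub i is Some j then x 0 j else c (i - n)%N.

Definition definable n (A : set 'rV[R]_n) : Prop :=
  exists (phi : formula L) (c : nat -> R),
    A = [set x | sat (assignment x c) phi].

(* [interval R] comprises the degenerate intervals `[a, a], i.e. points, and
   the unbounded ones. *)
Definition o_minimal : Prop :=
  forall A : set R, definable [set x : 'rV[R]_1 | A (x 0 0)] ->
  exists s : seq (interval R), A = \bigcup_(i in [set` s]) [set` i].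

(* [Phi] is the set of pairs (x, b) satisfying a formula phi(x, y). *)
Definition fiber n m (Phi : set 'rV[R]_(n + m)) (b : 'rV[R]_m) :
  set 'rV[R]_n := [set x | Phi (row_mx x b)].

Definition definable_family n (F : set (set 'rV[R]_n)) : Prop :=
  exists m (Phi : set 'rV[R]_(n + m)) (B : set 'rV[R]_m),
    [/\ definable Phi, definable B, B !=set0 & F = fiber Phi @` B].

(* Complete n-types over the model, as ultrafilters of definable sets. *)
Record complete_type n (p : set (set 'rV[R]_n)) : Prop := CompleteType {
  type_definable : forall A, p A -> definable A;
  type_set0 : ~ p set0;
  type_setI : forall A B, p A -> p B -> p (A `&` B);
  type_sub : forall A B, definable B -> A `<=` B -> p A -> p B;
  type_total : forall A, definable A -> p A \/ p (~` A)
}.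

Definition definable_type n (p : set (set 'rV[R]_n)) : Prop :=
  complete_type p /\
  forall m (Phi : set 'rV[R]_(n + m)), definable Phi ->
    definable [set b | p (fiber Phi b)].

Section Topology.
Context {n : nat} {X : set 'rV[R]_n}.

(* [tau] is an arbitrary topology on the points of [X], unrelated to the
   Euclidean one; [Topological.Pack] is used explicitly so that no canonical
   topology on the subtype [X] is ever selected. *)
Definition topspace (tau : Topological X) : topologicalType :=
  Topological.Pack tau.

Definition definable_topology (tau : Topological X) : Prop :=
  exists F : set (set 'rV[R]_n),
    [/\ definable_family F, (forall A, F A -> A `<=` X) &
        basis [set (val @^-1` A : set (topspace tau)) | A in F]].

Definition type_limit (tau : Topological X) (p : set (set 'rV[R]_n))
    (a : topspace tau) : Prop :=
  forall C : set (topspace tau), closed C -> p (val @` C) -> C a.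

(* In o-minimal structures this type-theoretic definition agrees with those by
   downward directed families of closed sets and by finite transversals. *)
Definition definably_compact (tau : Topological X) : Prop :=
  forall p : set (set 'rV[R]_n), definable_type p -> p X ->
    exists a : topspace tau, type_limit p a.

End Topology.
End Definability.

(* Main.v *)
Require Import Defs.
From mathcomp Require Import finmap.
From mathcomp Require Import all_boot all_order all_algebra.
From mathcomp Require Import all_classical reals topology.
From mathcomp Require Import lra.

Set Implicit Arguments.
Unset Strict Implicit.
Unset Printing Implicit Defensive.

Import Order.TTheory GRing.Theory Num.Theory.
Local Open Scope classical_set_scope.
Local Open Scope ring_scope.

(* Over R every type is definable (the Marker-Steinhorn theorem).  Hence the
   definable sets of an ultrafilter on X form a definable type, any limit of
   which is a limit of the ultrafilter, so type-compactness gives compactness.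
   Conversely, if a definable type has no limit, the complements of closed sets
   witnessing this cover X, and a finite subcover contradicts the finite
   intersection property of the type.

   Definability of types goes by induction on the number of variables.  Given a
   type p(x, y) and a definable family, uniform finiteness reduces to sets
   whose fibres in y are up-closed; the restriction of p to x then compares the
   members of the family by inclusion, a definable total preorder on the
   parameters, in which the parameters of the members of p form a cut.  So it
   suffices that every cut D of a definable total preorder on R^m is definable.
   If some line is cofinal in D, or coinitial in its complement, this is the
   case m = 1, where D is the set of elements below an ultrafilter.  If an
   interval [b0, b1] around the cut has empty interior, it is a finite union of
   graphs over R^(m-1).  Otherwise, wherever D changes along a line, the line
   jumps over a set with nonempty interior; only finitely many points of a line
   can do so, and between these points D contains a line piece entirely or not
   at all, which leaves a cut on R^(m-1).

   Over R, uniform finiteness needs no cell decomposition: uncountability of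
   intervals replaces the generic continuity arguments. *)
Definition upd (T : Type) (v : nat -> T) (i : nat) (a : T) : nat -> T :=
  fun j => if j == i then a else v j.

Definition scons (T : Type) (a : T) (v : nat -> T) : nat -> T :=
  fun j => if j is j'.+1 then v j' else a.

(** At least [k] elements of [A] lie strictly below [z]; for fixed [k] this is first-order, as is
    the exact count [stage]. *)
Fixpoint below {R : realType} k (A : R -> Prop) z : Prop :=
  if k is k'.+1 then exists a, a < z /\ A a /\ below k' A a else True.

Definition stage {R : realType} k (A : R -> Prop) z := below k A z /\ ~ below k.+1 A z.

(** * Definable predicates on valuations *)

Section Renaming.
Context {L : language} {R : realType} (M : expansion L R).

Fixpoint ren_term (f : nat -> nat) (t : term L) : term L :=
  match t with
  | Var i => Var (f i)
  | App g ts => App g (fun i => ren_term f (ts i))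
  end.

Definition ren_up (f : nat -> nat) (i : nat) : nat :=
  if i is j.+1 then (f j).+1 else 0%N.

Fixpoint ren (f : nat -> nat) (phi : formula L) : formula L :=
  match phi with
  | Equal s t => Equal (ren_term f s) (ren_term f t)
  | Less s t => Less (ren_term f s) (ren_term f t)
  | Rel r ts => @Rel L r (fun i => ren_term f (ts i))
  | Not psi => Not (ren f psi)
  | And psi chi => And (ren f psi) (ren f chi)
  | Exists psi => Exists (ren (ren_up f) psi)
  end.

Lemma eval_ren f v t : Defs.eval M v (ren_term f t) = Defs.eval M (v \o f) t.
Proof.
elim: t => [i|g ts IH] //=.
by congr fun_interp; apply/funext => i; exact: IH.
Qed.

Lemma sat_ren phi : forall f v, sat M v (ren f phi) = sat M (v \o f) phi.
Proof.
elim: phi => [s t|s t|r ts|p IH|p IHp q IHq|p IH] f v /=.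
- by rewrite !eval_ren.
- by rewrite !eval_ren.
- by congr rel_interp; apply/funext => i; rewrite eval_ren.
- by rewrite IH.
- by rewrite IHp IHq.
- congr (ex _); apply/funext => a; rewrite IH.
  by congr sat; apply/funext => -[|i].
Qed.

Lemma eval_local (t : term L) : exists N, forall v v' : nat -> R,
  (forall i, (i < N)%N -> v i = v' i) -> Defs.eval M v t = Defs.eval M v' t.
Proof.
elim: t => [i|g ts IH]; first by exists i.+1 => v v' /= ->.
have [N NP] := choice IH.
exists (\max_i N i)%N => v v' vv' /=; congr fun_interp; apply/funext => i.
by apply: NP => j jN; apply: vv'; apply: leq_trans jN _; exact: leq_bigmax.
Qed.

Lemma sat_local (phi : formula L) : exists N, forall v v' : nat -> R,
  (forall i, (i < N)%N -> v i = v' i) -> sat M v phi = sat M v' phi.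
Proof.
elim: phi => [s t|s t|r ts|p [N NP]|p [N NP] q [N' NP']|p [N NP]].
- have [N NP] := eval_local s; have [N' NP'] := eval_local t.
  exists (maxn N N') => v v' vv' /=.
  by rewrite (NP v v') ?(NP' v v') // => i iN; apply: vv'; rewrite leq_max iN ?orbT.
- have [N NP] := eval_local s; have [N' NP'] := eval_local t.
  exists (maxn N N') => v v' vv' /=.
  by rewrite (NP v v') ?(NP' v v') // => i iN; apply: vv'; rewrite leq_max iN ?orbT.
- have [N NP] := choice (fun i => eval_local (ts i)).
  exists (\max_i N i)%N => v v' vv' /=; congr rel_interp; apply/funext => i.
  by apply: NP => j jN; apply: vv'; apply: leq_trans jN _; exact: leq_bigmax.
- by exists N => v v' vv' /=; rewrite (NP v v').
- exists (maxn N N') => v v' vv' /=.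
  by rewrite (NP v v') ?(NP' v v') // => i iN; apply: vv'; rewrite leq_max iN ?orbT.
- exists N => v v' vv' /=; congr (ex _); apply/funext => a; apply: NP.
  by move=> [|i] // iN; apply: vv'; exact: ltnW.
Qed.
End Renaming.

Section DefinablePredicates.
Context {L : language} {R : realType} (M : expansion L R).
Implicit Types (u v w : nat -> R).

(* A predicate on valuations is definable when it is the satisfaction of a
   formula each of whose variables is substituted by a variable of the
   valuation or by a real parameter; this form is closed under substitution. *)
Definition sel (s : nat + R) v : R :=
  match s with inl j => v j | inr a => a end.

Definition coord (f : (nat -> R) -> R) := exists s, forall v, f v = sel s v.

Definition dfn (P : (nat -> R) -> Prop) := exists (phi : formula L) s,
  forall v, P v <-> sat M (fun i => sel (s i) v) phi.

Definition dfn2 (K : (nat -> R) -> R -> Prop) :=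
  dfn (fun v => K (fun j => v j.+1) (v 0%N)).

(* The variables of the two arguments are interleaved. *)
Definition dfnR (K : (nat -> R) -> (nat -> R) -> Prop) :=
  dfn (fun v => K (fun j => v j.*2) (fun j => v j.*2.+1)).

Lemma dfn_iff P Q : (forall v, P v <-> Q v) -> dfn P -> dfn Q.
Proof. by move=> PQ [phi [s Ps]]; exists phi, s => v; rewrite -PQ. Qed.

Lemma dfn_sub P (T : (nat -> R) -> nat -> R) :
  dfn P -> (forall j, coord (fun v => T v j)) -> dfn (fun v => P (T v)).
Proof.
move=> [phi [s Ps]] /choice[t Tt].
exists phi, (fun i => match s i with inl j => t j | inr a => inr a end) => v.
rewrite Ps; suff -> : (fun i => sel (s i) (T v)) =
  (fun i => sel (match s i with inl j => t j | inr a => inr a end) v) by [].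
by apply/funext => i; case: (s i) => //= j; rewrite Tt.
Qed.

Lemma dfn2_sub K T f : dfn2 K -> (forall j, coord (fun v => T v j)) ->
  coord f -> dfn (fun v => K (T v) (f v)).
Proof.
move=> dK cT cf; apply: (dfn_sub (T := fun v => scons (f v) (T v)) dK) => -[//|j].
exact: cT.
Qed.

Lemma dfnR_sub K T T' : dfnR K -> (forall j, coord (fun v => T v j)) ->
  (forall j, coord (fun v => T' v j)) -> dfn (fun v => K (T v) (T' v)).
Proof.
move=> dK cT cT'.
pose W v j := if odd j then T' v j./2 else T v j./2.
have cW j : coord (fun v => W v j).
  by rewrite /W; case: (odd j); [exact: cT'|exact: cT].
apply: dfn_iff (dfn_sub dK cW) => v /=.
suff [-> ->] : (fun j => W v j.*2) = T v /\ (fun j => W v j.*2.+1) = T' v by [].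
by split; apply/funext => j; rewrite /W /= ?odd_double ?uphalf_double ?doubleK.
Qed.

Lemma dfn_not P : dfn P -> dfn (fun v => ~ P v).
Proof. by move=> [phi [s Ps]]; exists (Not phi), s => v; rewrite Ps. Qed.

Lemma dfn_and P Q : dfn P -> dfn Q -> dfn (fun v => P v /\ Q v).
Proof.
move=> [phi [s Ps]] [psi [t Qt]].
(* Each formula carries its own substitution, so their variables are moved to even and odd indices
   respectively. *)
exists (And (ren double phi) (ren (fun j => j.*2.+1) psi)).
exists (fun i => if odd i then t i./2 else s i./2) => v.
rewrite /= !sat_ren Ps Qt.
set f := (fun i => _) \o double; set g := (fun i => _) \o _.
have -> : f = fun i => sel (s i) v.
  by apply/funext => i; rewrite /f /= odd_double doubleK.
have -> // : g = fun i => sel (t i) v.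
by apply/funext => i; rewrite /g /= odd_double /= uphalf_double.
Qed.

Lemma dfn_ex (P : (nat -> R) -> R -> Prop) :
  dfn2 P -> dfn (fun v => exists z, P v z).
Proof.
move=> [phi [s Ps]].
(* Variables reading the quantified coordinate become the bound variable, the others are shifted
   past it. Where [s i] is [inl 0], the value [t i] is never read. *)
pose f i := if s i is inl 0 then 0%N else i.+1.
pose t i := if s i is inl j then inl j.-1 else s i.
exists (Exists (ren f phi)), t => v /=.
have E z : P v z <-> sat M (fun i => sel (s i) (scons z v)) phi.
  by rewrite -(Ps (scons z v)).
suff H z : sat M (fun i => if i is j.+1 then sel (t j) v else z) (ren f phi) =
           sat M (fun i => sel (s i) (scons z v)) phi.
  by split=> -[z Pz]; exists z; move: Pz; rewrite H E.
rewrite sat_ren; congr sat; apply/funext => i /=.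
by rewrite /f /t; case E': (s i) => [[|j]|a] /=; rewrite ?E'.
Qed.

Lemma dfn_or P Q : dfn P -> dfn Q -> dfn (fun v => P v \/ Q v).
Proof.
move=> dP dQ; apply: (dfn_iff (P := fun v => ~ (~ P v /\ ~ Q v))).
  by move=> v; rewrite not_andP !notK.
by apply/dfn_not/dfn_and; exact: dfn_not.
Qed.

Lemma dfn_imp P Q : dfn P -> dfn Q -> dfn (fun v => P v -> Q v).
Proof.
move=> dP dQ; apply: (dfn_iff (P := fun v => ~ (P v /\ ~ Q v))).
  by move=> v; rewrite not_andP notK implyE; split=> [[]|[]]; auto.
by apply/dfn_not/dfn_and => //; exact: dfn_not.
Qed.

Lemma dfn_equiv P Q : dfn P -> dfn Q -> dfn (fun v => P v <-> Q v).
Proof. by move=> dP dQ; apply: dfn_and; exact: dfn_imp. Qed.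

Lemma dfn_all (P : (nat -> R) -> R -> Prop) :
  dfn2 P -> dfn (fun v => forall z, P v z).
Proof.
move=> dP; apply: (dfn_iff (P := fun v => ~ exists z, ~ P v z)).
  by move=> v; rewrite -forallNE; split=> H z; [exact: contrapT (H z)|move=> /(_ (H z))].
exact/dfn_not/dfn_ex/dfn_not.
Qed.

Lemma dfn_lt f g : coord f -> coord g -> dfn (fun v => f v < g v).
Proof.
move=> [s fs] [t gt].
exists (Less (Var 0%N) (Var 1%N)), (fun i => if i is 0%N then s else t) => v /=.
by rewrite fs gt.
Qed.

Lemma dfn_eq f g : coord f -> coord g -> dfn (fun v => f v = g v).
Proof.
move=> [s fs] [t gt].
exists (Equal (Var 0%N) (Var 1%N)), (fun i => if i is 0%N then s else t) => v /=.
by rewrite fs gt.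
Qed.

Lemma dfn_le f g : coord f -> coord g -> dfn (fun v => f v <= g v).
Proof.
move=> cf cg; apply: (dfn_iff _ (dfn_not (dfn_lt cg cf))) => v.
by rewrite leNgt; split=> [/negP|/negP].
Qed.

Lemma dfn_const (Q : Prop) : dfn (fun=> Q).
Proof.
have [q|nq] := pselect Q.
  apply: (dfn_iff (P := fun=> (0 : R) = 0)) => //.
  by apply: dfn_eq; exists (inr 0).
apply: (dfn_iff (P := fun=> (0 : R) < 0)) => [v|]; first by rewrite ltxx.
by apply: dfn_lt; exists (inr 0).
Qed.

Lemma coord_var j : coord (fun v => v j).
Proof. by exists (inl j). Qed.

Lemma coord_cst a : coord (fun=> a).
Proof. by exists (inr a). Qed.

Lemma coord_upd T f i j : (forall k, coord (fun v => T v k)) -> coord f ->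
  coord (fun v => upd (T v) i (f v) j).
Proof. by move=> cT cf; rewrite /upd; case: eqP. Qed.

Lemma coord_shift f : coord f -> coord (fun v => f (fun j => v j.+1)).
Proof.
move=> [[j|a] fs]; [exists (inl j.+1)|exists (inr a)] => v; exact: fs.
Qed.

Lemma dfn_below k (A : (nat -> R) -> R -> Prop) f :
  dfn2 A -> coord f -> dfn (fun v => below k (A v) (f v)).
Proof.
elim: k A f => [|k IH] A f dA cf /=; first exact: dfn_const.
apply: (dfn_ex (P := fun v a => a < f v /\ A v a /\ below k (A v) a)).
apply: dfn_and; first by apply: dfn_lt; [exact: coord_var|exact: coord_shift].
apply: dfn_and => //; apply: (IH (fun v => A (fun j => v j.+1))).
  by apply: (dfn2_sub (T := fun v j => v j.+2) (f := fun v => v 0%N) dA) => [j|]; exact: coord_var.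
exact: coord_var.
Qed.

Lemma dfn_stage k (A : (nat -> R) -> R -> Prop) f :
  dfn2 A -> coord f -> dfn (fun v => stage k (A v) (f v)).
Proof. by move=> dA cf; apply/dfn_and/dfn_not; exact: dfn_below. Qed.

(** The codomain [T] is arbitrary, so that relations and families of sets, curried in a valuation,
    are covered as well as predicates. *)
Definition dep (T : Type) (V : seq nat) (P : (nat -> R) -> T) :=
  forall v w, (forall i, i \in V -> v i = w i) -> P v = P w.

Lemma dfn_local P : dfn P -> exists N, dep (iota 0 N) P.
Proof.
move=> [phi [s Ps]]; have [N NP] := sat_local M phi.
pose b i := if s i is inl j then j.+1 else 0%N.
exists (\max_(i < N) b i)%N => v w vw; apply/propext.
rewrite !Ps (NP _ (fun i => sel (s i) w)) // => i iN.
have : (b i <= \max_(i < N) b i)%N := leq_bigmax (Ordinal iN).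
rewrite /b; case: (s i) => //= j jM.
by apply: vw; rewrite mem_iota.
Qed.

End DefinablePredicates.

Ltac solve_coord :=
  intros; cbv beta;
  lazymatch goal with
  | |- coord (fun v => upd (@?T v) ?i (@?f v) ?j) =>
      apply: (@coord_upd _ T f i j); [solve_coord | solve_coord]
  | |- coord (fun v => v ?j) => exact: coord_var
  | |- context [if ?b then _ else _] => case: b; solve_coord
  | |- coord _ => first [exact: coord_cst | idtac]
  end.

Ltac solve_dfn :=
  intros; cbv beta;
  lazymatch goal with
  | |- dfn2 _ _ => unfold dfn2; solve_dfn
  | |- dfnR _ _ => unfold dfnR; solve_dfn
  | |- dfn ?M (fun v => exists z, @?P v z) => apply: (@dfn_ex _ _ M P); solve_dfn
  | |- dfn ?M (fun v => @?P v /\ @?Q v) =>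
      apply: (@dfn_and _ _ M P Q); [solve_dfn | solve_dfn]
  | |- dfn ?M (fun v => @?P v \/ @?Q v) =>
      apply: (@dfn_or _ _ M P Q); [solve_dfn | solve_dfn]
  | |- dfn ?M (fun v => @?P v <-> @?Q v) =>
      apply: (@dfn_equiv _ _ M P Q); [solve_dfn | solve_dfn]
  | |- dfn ?M (fun v => ~ @?P v) => apply: (@dfn_not _ _ M P); solve_dfn
  | |- dfn ?M (fun v => is_true (@?f v < @?g v)) =>
      apply: (@dfn_lt _ _ M f g); solve_coord
  | |- dfn ?M (fun v => is_true (@?f v <= @?g v)) =>
      apply: (@dfn_le _ _ M f g); solve_coord
  | |- dfn ?M (fun v => @eq (_) (@?f v) (@?g v)) =>
      first [apply: (@dfn_eq _ _ M f g); solve_coord | apply: dfn_const | idtac]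
  | |- dfn ?M (fun v => @?P v -> @?Q v) =>
      apply: (@dfn_imp _ _ M P Q); [solve_dfn | solve_dfn]
  | |- dfn ?M (fun v => forall z, @?P v z) => apply: (@dfn_all _ _ M P); solve_dfn
  | |- dfn ?M (fun v => below ?k (@?A v) (@?f v)) =>
      apply: (@dfn_below _ _ M k A f); [solve_dfn | solve_coord]
  | |- dfn ?M (fun v => stage ?k (@?A v) (@?f v)) =>
      apply: (@dfn_stage _ _ M k A f); [solve_dfn | solve_coord]
  | H : dfn ?M ?K |- dfn ?M (fun v => ?K (@?T v)) =>
      apply: (@dfn_sub _ _ M K T H); solve_coord
  | H : dfn2 ?M ?K |- dfn ?M (fun v => ?K (@?T v) (@?f v)) =>
      apply: (@dfn2_sub _ _ M K T f H); solve_coord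
  | H : dfnR ?M ?K |- dfn ?M (fun v => ?K (@?T v) (@?T' v)) =>
      apply: (@dfnR_sub _ _ M K T T' H); solve_coord
  | |- dfn _ _ => first [apply: dfn_const | idtac]
  end.

(** * One-variable sets *)

Section TameSets.
Context {R : realType}.
Implicit Types (A B : R -> Prop) (s : seq R).

(** The finite unions of points and intervals, described by a finite list of possible break points.
    In this form Boolean combinations only concatenate lists. *)
Definition tame A := exists s, forall a b, a < b ->
  (forall x, x \in s -> x < a \/ b < x) -> (A a <-> A b).

Definition hasint A := exists a b, a < b /\ forall x, a < x -> x < b -> A x.

(** Local constancy; it fails exactly at the boundary points of [A]. *)
Definition locc A x := exists a b, (a < x /\ x < b) /\
  forall y, a < y -> y < b -> (A y <-> A x).

Definition fin A := exists s, forall x, A x -> x \in s.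

Lemma fin_sub A B : (forall x, A x -> B x) -> fin B -> fin A.
Proof. by move=> AB [s sB]; exists s => x /AB; exact: sB. Qed.

Lemma seq_gap s x : exists a b, (a < x /\ x < b) /\
  forall y, y \in s -> a < y -> y < b -> y = x.
Proof.
elim: s => [|y s [a [b [[ax xb] abs]]]].
  by exists (x - 1), (x + 1); split=> //; lra.
have [yx|xy|->] := ltgtP y x.
- exists (Num.max a y), b; rewrite gt_max ax yx; split=> // z.
  rewrite gt_max inE => /orP[/eqP->|zs] /andP[az yz] zb; last exact: abs.
  by rewrite ltxx in yz.
- exists a, (Num.min b y); rewrite lt_min xb xy; split=> // z.
  rewrite lt_min inE => /orP[/eqP->|zs] az /andP[zb zy]; last exact: abs.
  by rewrite ltxx in zy.
- by exists a, b; split=> // z; rewrite inE => /orP[/eqP->|zs] //; exact: abs.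
Qed.

Lemma seq_avoid s a b : a < b -> exists a' b', [/\ a < a', a' < b', b' < b &
  forall y, y \in s -> y < a' \/ b' < y].
Proof.
elim: s a b => [|y s IH] a b ab.
  by exists (a + (b - a) / 3), (b - (b - a) / 3); split=> //; lra.
have [a1 [b1 [aa1 ab1 b1b]]] := IH _ _ ab.
have [ya|ay] := ltP y ((a1 + b1) / 2) => H.
- exists ((a1 + b1) / 2), b1; split=> //; [lra|lra|].
  move=> z; rewrite inE => /orP[/eqP->|/H[]]; [by left| |by right].
  by move=> za; left; lra.
- exists a1, (a1 + (b1 - a1) / 4); split=> //; [lra|lra|].
  move=> z; rewrite inE => /orP[/eqP->|/H[]]; [by right; lra|by left|].
  by move=> zb; right; lra.
Qed.

Lemma tame_const A s a b : (forall a b, a < b ->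
    (forall x, x \in s -> x < a \/ b < x) -> (A a <-> A b)) ->
  (forall x, x \in s -> a < x -> x < b -> False) ->
  (forall x, a < x -> x < b -> A x) \/ (forall x, a < x -> x < b -> ~ A x).
Proof.
move=> sA sab.
have [|/forallNP nE] := pselect (exists x, a < x /\ x < b /\ A x); last first.
  by right=> x ax xb Ax; apply: (nE x).
move=> [x [ax [xb Ax]]]; left=> y ay yb.
have [xy|yx|<- //] := ltgtP x y.
- apply/(sA _ _ xy) => // z zs; have [zx|xz] := ltP z x; first by left.
  by right; rewrite ltNge; apply/negP => zy; apply: (sab z) => //; lra.
- apply/(sA _ _ yx) => // z zs; have [zx|xz] := ltP z y; first by left.
  by right; rewrite ltNge; apply/negP => zy; apply: (sab z) => //; lra.
Qed.

Lemma tame_subint A a b : tame A -> a < b -> exists a' b',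
  [/\ a < a', a' < b', b' < b & (forall x, a' < x -> x < b' -> A x) \/
    (forall x, a' < x -> x < b' -> ~ A x)].
Proof.
move=> [s sA] /(seq_avoid s)[a' [b' [aa' ab' bb' H]]].
exists a', b'; split=> //; apply: (tame_const sA) => x /H[]; lra.
Qed.

Lemma tame_locc A : tame A -> fin (fun x => ~ locc A x).
Proof.
move=> [s sA]; exists s => x; apply: contra_notT => xs.
have [a [b [[ax xb] abs]]] := seq_gap s x.
exists a, b; split=> // y ay yb.
have [H|H] : (forall x, a < x -> x < b -> A x) \/
             (forall x, a < x -> x < b -> ~ A x).
  apply: (tame_const sA) => z zs az zb.
  by move: xs; rewrite -(abs z) ?zs.
- by split=> _; apply: H.
- by split=> [/(H y ay yb)|/(H x ax xb)].
Qed.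

Lemma tame_hasint A : tame A -> hasint A \/ fin A.
Proof.
move=> [s sA]; have [fA|/forallNP nfA] := pselect (fin A); [by right|left].
have /existsNP[x /not_implyP[Ax /negP xs]] := nfA s.
have [a [b [[ax xb] abs]]] := seq_gap s x; exists a, b; split; first lra.
have [//|H] : (forall x, a < x -> x < b -> A x) \/
             (forall x, a < x -> x < b -> ~ A x).
  apply: (tame_const sA) => z zs az zb.
  by move: xs; rewrite -(abs z) ?zs.
by case: (H x ax xb).
Qed.

Lemma nonfin_hasint A : tame A -> (hasint A -> False) -> fin A.
Proof. by move=> /tame_hasint[]. Qed.

Lemma tame_and A B : tame A -> tame B -> tame (fun x => A x /\ B x).
Proof.
move=> [s sA] [t tB]; exists (s ++ t) => a b ab H.
by rewrite (sA a b) ?(tB a b) // => x xs; apply: H; rewrite mem_cat xs ?orbT.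
Qed.

Lemma tame_itv (c d : R) : tame (fun x => c < x /\ x < d).
Proof.
exists [:: c; d] => a b ab H.
have := H c; have := H d; rewrite !inE !eqxx orbT => /(_ isT) ? /(_ isT) ?.
by split; lra.
Qed.

(** Cantor's nested intervals: each interval lies strictly inside the previous one and avoids the
    next [F n]; the supremum of the left ends lies in all of them. *)
Lemma avoid_countable (F : nat -> seq R) a b : a < b ->
  exists x, [/\ a < x, x < b & forall n, x \notin F n].
Proof.
move=> ab.
have /choice[g gP] (sp : seq R * (R * R)) : exists q : R * R,
    sp.2.1 < sp.2.2 -> [/\ sp.2.1 < q.1, q.1 < q.2, q.2 < sp.2.2 &
      forall y, y \in sp.1 -> y < q.1 \/ q.2 < y].
  have [/(seq_avoid sp.1)[a' [b' H]]|_] := ltP sp.2.1 sp.2.2.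
    by exists (a', b').
  by exists 0.
pose p := fix p n : R * R := if n is n'.+1 then g (F n', p n') else (a, b).
have p12 n : (p n).1 < (p n).2 by elim: n => //= n /(gP (F n, p n))[].
have pS n := gP (F n, p n) (p12 n).
have up n m : (n <= m)%N -> (p n).1 <= (p m).1 /\ (p m).2 <= (p n).2.
  elim: m => [|m IH]; first by rewrite leqn0 => /eqP->.
  rewrite leq_eqVlt => /orP[/eqP-> //|/IH[h1 h2]].
  by have [h3 _ h4 _] := pS m; rewrite /= in h3 h4 *; lra.
have lt12 n m : (p n).1 < (p m).2.
  have [h1 _] := up _ _ (leq_maxl n m); have [_ h2] := up _ _ (leq_maxr n m).
  by have := p12 (maxn n m); lra.
pose E := [set (p n).1 | n in setT].
have E0 : E !=set0 by exists (p 0%N).1; exists 0%N.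
have uE n : ubound E (p n).2 by move=> _ [m _ <-]; exact/ltW.
have hE : has_sup E by split=> //; exists (p 0%N).2.
have x1 n : (p n).1 <= sup E by apply: sup_upper_bound => //; exists n.
have x2 n : sup E <= (p n).2 by apply: sup_le_ub.
exists (sup E); split.
- by have := x1 1%N; have [+ _ _ _] := pS 0%N => /=; lra.
- by have := x2 1%N; have [_ _ + _] := pS 0%N => /=; lra.
- move=> n; apply/negP; have [_ _ _ H] := pS n => /H /=.
  by have := x1 n.+1; have := x2 n.+1 => /=; lra.
Qed.

Lemma avoid_countType (T : countType) (A : T -> R -> Prop) a b : a < b ->
  (forall t, fin (A t)) -> exists x, [/\ a < x, x < b & forall t, ~ A t x].
Proof.
move=> ab /choice[F FA].
have [x [ax xb H]] :=
  avoid_countable (fun n => if unpickle n is Some t then F t else [::]) ab.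
exists x; split=> // t /FA xF; have := H (pickle t).
by rewrite pickleK xF.
Qed.

(** A tame set containing no subinterval of (a, b) meets it in a finite set, and countably many
    finite sets cannot cover (a, b). *)
Lemma tame_cover (T : countType) (A : T -> R -> Prop) a b : a < b ->
  (forall t, tame (A t)) -> (forall x, a < x -> x < b -> exists t, A t x) ->
  exists t a' b', [/\ a <= a', a' < b', b' <= b &
    forall x, a' < x -> x < b' -> A t x].
Proof.
move=> ab tA cA; apply: contrapT => nE.
have [|x [ax xb H]] :=
  avoid_countType (A := fun t x => (a < x /\ x < b) /\ A t x) ab.
  move=> t; apply: nonfin_hasint; first exact/tame_and/tA/tame_itv.
  move=> [a' [b' [ab' H]]]; apply: nE; exists t, a', b'; split=> //.
  - rewrite leNgt; apply/negP => a'a.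
    have [] := H ((a' + Num.min a b') / 2).
    + by have := ab'; case: (ltP a b') => ?; lra.
    + by have := ab'; case: (ltP a b') => ?; lra.
    + by case: (ltP a b') => ?; lra.
  - rewrite leNgt; apply/negP => a'a.
    have [] := H ((b' + Num.max b a') / 2).
    + by have := ab'; case: (ltP b a') => ?; lra.
    + by have := ab'; case: (ltP b a') => ?; lra.
    + by case: (ltP b a') => ?; lra.
  - by move=> x a'x xb'; have [] := H x a'x xb'.
by have [t At] := cA x ax xb; apply: (H t).
Qed.

(** Each fibre contains an interval with rational ends. There are countably many of these, so by
    [tame_cover] one of them serves a whole interval of [x]. *)
Lemma tame_box (P : R -> R -> Prop) a b : a < b ->
  (forall c d, tame (fun x => forall t, c < t -> t < d -> P x t)) ->
  (forall x, a < x -> x < b -> hasint (P x)) ->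
  exists a' b' c d, [/\ a <= a', a' < b', b' <= b, c < d &
    forall x t, a' < x -> x < b' -> c < t -> t < d -> P x t].
Proof.
move=> ab tP iP.
have [||[q q'] [a' [b' [aa' ab' bb' H]]]] := tame_cover
   (A := fun (q : rat * rat) x => ratr q.1 < ratr q.2 :> R /\
       forall t, ratr q.1 < t -> t < ratr q.2 -> P x t) ab.
- move=> q; apply: tame_and => //.
  by exists [::].
- move=> x ax xb; have [c [d [cd H]]] := iP x ax xb.
  have [q] := rat_in_itvoo cd; rewrite in_itv /= => /andP[cq qd].
  have [q'] := rat_in_itvoo qd; rewrite in_itv /= => /andP[qq' q'd].
  by exists (q, q'); split=> //= t qt tq'; apply: H; lra.
exists a', b', (ratr q), (ratr q'); split=> //.
  by have [] := H ((a' + b') / 2); [lra|lra|].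
by move=> x t ax xb; have [_] := H x ax xb; apply.
Qed.

(** Connectedness of [a, b], through the supremum of the initial segment on which [A] keeps its
    value at [a]. *)
Lemma locc_const A a b : a < b -> (forall x, a <= x -> x <= b -> locc A x) ->
  (A a <-> A b).
Proof.
move=> ab lA.
pose E := [set x | a <= x <= b /\ forall y, a <= y -> y <= x -> (A y <-> A a)].
have Ea : E a.
  split; first by rewrite lexx ltW.
  by move=> y ay ya; have -> : y = a by lra.
have hE : has_sup E by split; [exists a|exists b => x [/andP[]]].
have aE : a <= sup E by apply: sup_upper_bound.
have Eb : sup E <= b by apply: sup_le_ub; [exists a|move=> x [/andP[]]].
have [c [d [[cx xd] cdA]]] := lA _ aE Eb.
have [e Ee ce] := sup_gt (ex_intro _ a Ea) cx.
have eE : e <= sup E by apply: sup_upper_bound.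
have [/andP[ae eb] eA] := Ee.
have HA : A (sup E) <-> A a.
  have ed : e < d := le_lt_trans eE xd.
  by have := cdA e ce ed; have := eA e ae (lexx _); tauto.
have [bd|db] := ltP b d.
  by have := cdA b (lt_le_trans cx Eb) bd; move: HA; tauto.
set m := (sup E + d) / 2.
have [sm md] : sup E < m /\ m < d by split; rewrite /m midf_lt.
suff : E m by move=> /(sup_upper_bound hE); rewrite leNgt sm.
split=> [|y ay ym].
  by rewrite (le_trans aE (ltW sm)) (le_trans (ltW md) db).
have [ye|ey] := leP y e; first exact: eA.
by rewrite -HA cdA //; [exact: lt_trans ey|exact: le_lt_trans md].
Qed.

End TameSets.

(** * Counting the elements of a set below a point *)

Section Counting.
Context {R : realType}.
Implicit Types (A B : R -> Prop) (s : seq R).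

Lemma below_mono k A z z' : z <= z' -> below k A z -> below k A z'.
Proof. by case: k => //= k zz' [a [az H]]; exists a; split; [lra|]. Qed.

Lemma below_sub k A B z : (forall x, A x -> B x) -> below k A z -> below k B z.
Proof.
by move=> AB; elim: k z => //= k IH z [a [az [Aa /IH]]]; exists a; auto.
Qed.

Lemma below_leq k k' A z : (k' <= k)%N -> below k A z -> below k' A z.
Proof.
move=> /subnK <-; elim: (k - k')%N z => // m IH z.
rewrite addSn /= => -[a [az [_ /IH]]]; apply: below_mono; lra.
Qed.

Lemma fin_below A : fin A -> exists k, forall z, ~ below k A z.
Proof.
move=> [s sA]; exists (size s).+1 => z H.
suff [t [tk ut tA]] : exists t : seq R, [/\ size t = (size s).+1, uniq t &
    forall x, x \in t -> x < z /\ A x].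
  by have := uniq_leq_size ut (fun x xt => sA x (tA x xt).2); rewrite tk ltnn.
elim: (size s).+1 z H => [|k IH] z /=; first by exists [::].
move=> [a [az [Aa /IH[t [tk ut tA]]]]]; exists (a :: t); split=> /=.
- by rewrite tk.
- by rewrite ut andbT; apply/negP => /tA[]; rewrite ltxx.
- by move=> x; rewrite inE => /orP[/eqP-> //|/tA[xa Ax]]; split=> //; lra.
Qed.

Lemma below_gap k A z0 z : z0 <= z -> (forall t, z0 <= t -> t < z -> ~ A t) ->
  (below k A z <-> below k A z0).
Proof.
move=> z0z nA; split; last exact: below_mono.
case: k => //= k [a [az [Aa H]]]; exists a; split=> //.
by rewrite ltNge; apply/negP => /nA; exact.
Qed.

Lemma below_one k A z0 z y : z0 <= y -> y < z -> A y ->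
  (forall t, z0 <= t -> t < z -> A t -> t = y) ->
  (below k.+1 A z <-> below k A z0).
Proof.
move=> z0y yz Ay yA; split; last first.
  by move=> H; exists y; do 2?split=> //; exact: below_mono H.
move=> [a [az [Aa H]]]; have [z0a|az0] := leP z0 a; last first.
  by apply: below_mono H; lra.
move: H; rewrite (yA a) //; apply: (below_gap k z0y _).1 => t z0t ty At.
have E : t = y by apply: yA => //; lra.
by move: ty; rewrite E ltxx.
Qed.

Lemma stageP k A z : ~ below k A z -> exists2 t, (t < k)%N & stage t A z.
Proof.
elim: k => [[]//|k IH] nL.
have [H|/IH[t tk]] := pselect (below k A z); first by exists k.
by exists t => //; exact: ltnW.
Qed.

(** The count is of elements strictly below, so an element in [a, b) would raise the count at [b];
    only [b] itself has to be excluded by hypothesis. *)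
Lemma stage_conv k A a b x : stage k A a -> stage k A b -> ~ A b ->
  a <= x -> x <= b -> stage k A x /\ ~ A x.
Proof.
move=> [La _] [_ Lb] Ab ax xb; split.
  by split; [exact: below_mono La|move=> /(below_mono xb)].
move=> Ax; have [xb'|] := ltP x b; last first.
  by move=> bx; have E : x = b by [lra]; case: Ab; rewrite -E.
by apply: Lb; exists x; split=> //; split=> //; exact: below_mono La.
Qed.

Lemma stage_inj k A a b : stage k A a -> stage k A b -> A a -> A b -> a = b.
Proof.
move=> [La La'] [Lb Lb'] Aa Ab; have [ab|ba|//] := ltgtP a b.
- by case: Lb'; exists a.
- by case: La'; exists b.
Qed.

Lemma fin_isolated A x : fin A -> exists a b, (a < x /\ x < b) /\
  forall y, a < y -> y < b -> A y -> y = x.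
Proof.
move=> [s sA]; have [a [b [axb H]]] := seq_gap s x.
by exists a, b; split=> // y ay yb /sA ys; exact: H.
Qed.

Lemma stage_open k A x : fin A -> stage k A x -> ~ A x -> exists a b,
  (a < x /\ x < b) /\ forall y, a < y -> y < b -> stage k A y /\ ~ A y.
Proof.
move=> fA [Lx Lx'] Ax; have [a [b [axb H]]] := fin_isolated x fA.
have nA y : a < y -> y < b -> ~ A y.
  by move=> ay yb Ay; apply: Ax; rewrite -(H y ay yb Ay).
exists a, b; split=> // y ay yb; split; last exact: nA.
have [xy|yx] := leP x y.
  have E j := below_gap j xy (A := A).
  by split; rewrite E // => t xt ty; apply: nA; lra.
have E j := below_gap j (ltW yx) (A := A).
by split; rewrite -E // => t xt ty; apply: nA; lra.
Qed.

Lemma fin_max_below A z : fin A -> (exists y, y < z /\ A y) ->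
  exists y, [/\ y < z, A y & forall t, y < t -> t < z -> ~ A t].
Proof.
move=> fA [y [yz Ay]]; apply: contrapT => nE.
have up x : x < z -> A x -> exists2 t, x < t & t < z /\ A t.
  move=> xz Ax; apply: contrapT => nt; apply: nE; exists x; split=> // t xt tz At.
  by apply: nt; exists t.
have [k Lk] := fin_below fA.
suff [x [xz Ax /Lk//]] : exists x, [/\ x < z, A x & below k A x].
elim: k {Lk} => [|k [x [xz Ax Lx]]]; first by exists y.
have [t xt [tz At]] := up x xz Ax.
by exists t; split=> //; exists x.
Qed.

End Counting.

(** * Definable sets as definable predicates, and o-minimality as tameness *)

Section OMinimal.
Context {L : language} {R : realType} (M : expansion L R).

Definition rowv n (v : nat -> R) : 'rV[R]_n := \row_i v i.

Lemma definable_dfn n (A : set 'rV[R]_n) :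
  definable M A <-> dfn M (fun v => A (rowv n v)).
Proof.
split=> [[phi [c ->]]|[phi [s Ps]]].
  exists phi, (fun i => if (i < n)%N then inl i else inr (c (i - n)%N)) => v /=.
  set f := assignment _ _; suff -> : f = fun i =>
    sel (if (i < n)%N then inl i else inr (c (i - n)%N)) v by [].
  apply/funext => i; rewrite /f /assignment; case: insubP => [j jn <-|].
    by rewrite ltn_ord mxE.
  by move=> /negbTE ->.
(* Coordinates of index at least [n] do not affect [A] and are set to 0; together with the true
   parameters they are stored from index [n] on. *)
pose f i := if s i is inl j then if (j < n)%N then j else (n + i)%N
            else (n + i)%N.
pose c i := if s i is inr a then a else 0.
exists (ren f phi), c; apply/funext => x; apply/propext.
pose v i := if insub i is Some j then x 0 j else 0.
have -> : A x = A (rowv n v).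
  by congr A; apply/rowP => i; rewrite !mxE /v valK.
rewrite Ps /= sat_ren.
suff <- : (fun i => sel (s i) v) = assignment x c \o f by [].

apply/funext => i; rewrite /= /f /assignment; case E: (s i) => [j|a] /=; last first.
  by rewrite insubN ?addKn /c ?E // -leqNgt leq_addr.
rewrite /v; case: ltnP => jn; last first.
  by rewrite !insubN ?addKn /c ?E // -leqNgt ?leq_addr.
by case: insubP => //; rewrite jn.
Qed.

Hypothesis oM : o_minimal M.

Lemma interval_tame (i : interval R) : tame (fun x => x \in i).
Proof.
pose e (b : itv_bound R) := if b is BSide _ x then [:: x] else [::].
case: i => l r; exists (e l ++ e r) => a b ab.
case: l => [[] x|[]]; case: r => [[] y|[]] /= H; rewrite !in_itv /=;
  try (have := H x); try (have := H y); rewrite ?inE ?eqxx ?orbT /=;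
  repeat move=> /(_ isT); rewrite ?andbT ?andbF; split; lra.
Qed.

Lemma dfn_tame (A : R -> Prop) : dfn M (fun v => A (v 0%N)) -> tame A.
Proof.
move=> dA; have [|s sA] := oM (A := A).
  by apply/definable_dfn; apply: dfn_iff dA => v; rewrite /= mxE.
have -> : A = \bigcup_(i in [set` s]) [set` i] := sA.
elim: s {sA} => [|i s [t tP]].
  by exists [::] => a b _ _; split=> -[].
have [t' t'P] := interval_tame i.
exists (t' ++ t) => a b ab H.
have E x : (\bigcup_(j in [set` i :: s]) [set` j]) x <->
    x \in i \/ (\bigcup_(j in [set` s]) [set` j]) x.
  split=> [[j /=]|[xi|[j js xj]]].
  - by rewrite inE => /orP[/eqP->|js] xj; [left|right; exists j].
  - by exists i => //=; rewrite mem_head.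
  - by exists j => //=; rewrite inE [in j \in s]js orbT.
rewrite !E (t'P a b) ?(tP a b) // => x xt; apply: H.
all: by rewrite mem_cat xt ?orbT.
Qed.

End OMinimal.

Ltac solve_tame oM := apply: (dfn_tame oM); solve_dfn.

Lemma upd_id (T : Type) (v : nat -> T) i : upd v i (v i) = v.
Proof. by apply/funext => j; rewrite /upd; case: eqP => // ->. Qed.

Lemma upd_upd (T : Type) (v : nat -> T) i a b : upd (upd v i a) i b = upd v i b.
Proof. by apply/funext => j; rewrite /upd; case: eqP. Qed.

Lemma updE (T : Type) (v : nat -> T) i a : upd v i a i = a.
Proof. by rewrite /upd eqxx. Qed.

Lemma updC (T : Type) (v : nat -> T) i j a b : i != j ->
  upd (upd v i a) j b = upd (upd v j b) i a.
Proof.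
move=> ij; apply/funext => k; rewrite /upd.
by have [->|//] := eqVneq k j; rewrite eq_sym (negbTE ij).
Qed.

(** * Uniform finiteness *)

Section LocalCount.
Context {L : language} {R : realType} (M : expansion L R).
Hypothesis oM : o_minimal M.
Implicit Types (v w : nat -> R) (K : (nat -> R) -> R -> Prop).

(** Neighbourhoods are taken within a single coordinate line. *)
Definition near_upd i v (P : (nat -> R) -> Prop) := exists a b,
  (a < v i /\ v i < b) /\ forall x, a < x -> x < b -> P (upd v i x).

Lemma near_upd_self i v P : near_upd i v P -> P v.
Proof. by move=> [a [b [[av vb] H]]]; have := H _ av vb; rewrite upd_id. Qed.

Lemma near_upd_and i v P Q (S : (nat -> R) -> Prop) :
  (forall w, P w -> Q w -> S w) ->
  near_upd i v P -> near_upd i v Q -> near_upd i v S.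
Proof.
move=> PQS [a [b [[av vb] H]]] [a' [b' [[av' vb'] H']]].
exists (Num.max a a'), (Num.min b b').
rewrite gt_max lt_min av av' vb vb'; split=> // x.
by rewrite gt_max lt_min => /andP[? ?] /andP[? ?]; apply: PQS; auto.
Qed.

Lemma near_upd_all i v P : (forall w, P w) -> near_upd i v P.
Proof. by move=> aP; exists (v i - 1), (v i + 1); split=> //; lra. Qed.

Lemma near_upd_sub i v P (S : (nat -> R) -> Prop) :
  (forall w, P w -> S w) -> near_upd i v P -> near_upd i v S.
Proof. by move=> PS [a [b [vab H]]]; exists a, b; split=> // x ax /(H _ ax)/PS. Qed.

Lemma near_upd_locc i v x P : P (upd v i x) ->
  locc (fun y => P (upd v i y)) x -> near_upd i (upd v i x) P.
Proof.
move=> Px [a [b [[ax xb] H]]]; exists a, b; rewrite updE; split=> // y ay yb.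
by rewrite upd_upd; apply/H.
Qed.

Definition single K w (z z' : R) := exists t, (z <= t /\ t <= z') /\ K w t /\
  forall t', z <= t' -> t' <= z' -> K w t' -> t' = t.

Definition empty K w (z z' : R) := forall t, z <= t -> t <= z' -> ~ K w t.

(* Unlike "the number of elements of [K w] is constant for [w] near [v]", this
   condition is visibly first-order. *)
Definition good K i v :=
  (forall y, K v y -> exists z z', (z < y /\ y < z') /\
     near_upd i v (fun w => single K w z z')) /\
  (forall z z', empty K v z z' -> near_upd i v (fun w => empty K w z z')) /\
  (exists z, near_upd i v (fun w => forall t, K w t -> t < z)) /\
  (exists z, near_upd i v (fun w => forall t, K w t -> z < t)).

Lemma good_dfn K i : dfn2 M K -> dfn M (good K i).
Proof.
move=> dK; rewrite /good /near_upd /single /empty.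
by solve_dfn.
Qed.

(** Induction on [k], moving left: the last element of [K v] below [z] is isolated in a window
    [z1, z2] that keeps exactly one element for nearby [w], so the count at [z] is one more than the
    count at [z1]. *)
Lemma good_below K i v z k : fin (K v) -> good K i v -> ~ K v z ->
  near_upd i v (fun w => below k (K w) z <-> below k (K v) z).
Proof.
move=> fK [gs [ge [_ [zb Hb]]]]; elim: k z => [|k IH] z nKz.
  exact: near_upd_all.
have [[y [yz Kvy]]|nE] := pselect (exists y, y < z /\ K v y); last first.
  have [|a] := ge (Num.min zb z) z.
    move=> t; rewrite ge_min => t1; rewrite le_eqVlt => /orP[/eqP->//|tz] Kt.
    by apply: nE; exists t.
  move=> [b Hab]; have {Hab} : near_upd i v (fun w => empty K w (Num.min zb z) z).
    by exists a, b.
  apply: near_upd_and Hb => w Hb He.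
  split=> -[t [tz [Kt _]]]; last by case: nE; exists t.
  by case: (He t _ (ltW tz) Kt); rewrite ge_min (ltW (Hb _ Kt)).
have {y yz Kvy} [y [yz Kvy ymax]] := fin_max_below fK (ex_intro _ y (conj yz Kvy)).
have [z1 [z2 [[z1y yz2] H1]]] := gs y Kvy.
have [t0 [[z1t0 t0z2] [Kt0 t0u]]] := near_upd_self H1.
have E : y = t0 by apply: t0u => //; lra.
subst t0.
have nK1 : ~ K v z1 by move=> /t0u E; move: (E (lexx _)); lra.
have := IH _ nK1.
(* The minimum and maximum treat both positions of [z] relative to [z2]: nothing of [K w] lies
   between the two, so the element of the window stays below [z]. *)
have : near_upd i v (fun w => empty K w (Num.min z z2) (Num.max z z2)).
  apply: ge => t; rewrite ge_min le_max => t1 t2 Kt.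
  have [zt|tz|tz] := ltgtP z t; last by rewrite tz in nKz.
  - by have := t0u t; move: t2; rewrite leNgt zt /= => tz2 /(_ _ _ Kt); lra.
  - move: t1; rewrite leNgt tz /= => z2t.
    by apply: (ymax t) => //; lra.
move=> He; have {H1 He} : near_upd i v (fun w => single K w z1 z2 /\
    empty K w (Num.min z z2) (Num.max z z2)) by apply: near_upd_and H1 He.
have key w : single K w z1 z2 /\ empty K w (Num.min z z2) (Num.max z z2) ->
    below k.+1 (K w) z <-> below k (K w) z1.
  move=> [[t [[z1t tz2] [Kt tu]]] He].
  have lt t' : t' < z \/ t' <= z2 -> K w t' -> t' < Num.min z z2.
    move=> t'z Kt'; rewrite ltNge; apply/negP => /He /(_ _ Kt'); apply.
    by rewrite le_max; case: t'z => [/ltW|] ->; rewrite ?orbT.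
  have := lt t (or_intror tz2) Kt; rewrite lt_min => /andP[tz _].
  apply: (below_one _ z1t tz Kt) => t' z1t' t'z Kt'; apply: tu => //.
  by have := lt t' (or_introl t'z) Kt'; rewrite lt_min => /andP[_ /ltW].
move=> H; have kv := key v (near_upd_self H).
by apply: near_upd_and H => w /key-> ->; rewrite kv.
Qed.

Definition count_ge k K w := exists z, below k (K w) z.

(** A common upper bound [z] of the nearby sets turns the total count into the count below [z]. *)
Lemma good_count K i v k : fin (K v) -> good K i v ->
  near_upd i v (fun w => count_ge k K w <-> count_ge k K v).
Proof.
move=> fK gK; have [_ [_ [[z Hz] _]]] := gK.
have E w : (forall t, K w t -> t < z) -> (count_ge k K w <-> below k (K w) z).
  move=> tz; split=> [[z' H]|]; last by exists z.
  have [|zz'] := leP z' z; first by move=> /below_mono; exact.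
  by apply: (below_gap k (ltW zz') _).1 H => t zt _ /tz; lra.
have nKz : ~ K v z by move=> /(near_upd_self Hz); rewrite ltxx.
have Ev := E v (near_upd_self Hz).
by apply: near_upd_and Hz (good_below k fK gK nKz) => w /E-> ->; rewrite Ev.
Qed.

(** On an interval of bad points, [tame_cover] first gives a subinterval on which the sets are
    uniformly bounded. A point of it generic for countably many conditions is then good, a
    contradiction. *)
Lemma good_cofinite K i v : dfn2 M K -> (forall v, fin (K v)) ->
  fin (fun a => ~ good K i (upd v i a)).
Proof.
move=> dK fK; have dG := good_dfn i dK.
apply: nonfin_hasint; first by solve_tame oM.
move=> [a [b [ab H]]].
have [||n [a1 [b1 [aa1 ab1 b1b Hn]]]] := tame_cover
   (A := fun (n : nat) x => forall t, K (upd v i x) t -> t < n%:R) ab.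
- by move=> n; solve_tame oM.
- move=> x _ _; have [s sK] := fK (upd v i x).
  elim: s (K _) sK => [|y s IH] A sA; first by exists 0%N => t /sA.
  have [|n nP] := IH (fun t => A t /\ t != y).
    by move=> t [/sA]; rewrite inE => /orP[->|].
  exists (maxn n (Num.truncn y).+1) => t At; have [->|ty] := eqVneq t y.
    apply: lt_le_trans (truncnS_gt _) _; by rewrite ler_nat leq_maxr.
  by apply: lt_le_trans (nP t _) _ => //; rewrite ler_nat leq_maxl.
have [||m [a2 [b2 [aa2 ab2 b2b Hm]]]] := tame_cover
   (A := fun (n : nat) x => forall t, K (upd v i x) t -> - n%:R < t) ab1.
- by move=> m; solve_tame oM.
- move=> x _ _; have [s sK] := fK (upd v i x).
  elim: s (K _) sK => [|y s IH] A sA; first by exists 0%N => t /sA.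
  have [|p pP] := IH (fun t => A t /\ t != y).
    by move=> t [/sA]; rewrite inE => /orP[->|].
  exists (maxn p (Num.truncn (- y)).+1) => t At; rewrite ltrNl.
  have [->|ty] := eqVneq t y.
    apply: lt_le_trans (truncnS_gt _) _; by rewrite ler_nat leq_maxr.
  by apply: lt_le_trans (_ : _ < p%:R) _; rewrite ?ler_nat ?leq_maxl // ltrNl; exact: pP.
(* For each rational window, the conditions [single] and [empty] change at finitely many points of
   the line only; [x] avoids all these points. *)
have [|x [ax xb Hx]] := avoid_countType (A := fun (t : bool * (rat * rat)) x =>
    ~ locc (fun x => if t.1 then single K (upd v i x) (ratr t.2.1) (ratr t.2.2)
                     else empty K (upd v i x) (ratr t.2.1) (ratr t.2.2)) x) ab2.
  move=> [[] [q q']] /=; apply: tame_locc; rewrite /single /empty; by solve_tame oM.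
have {}Hx t := contrapT (Hx t).
case: (H x); [lra|lra|]; split; [|split; [|split]].
- move=> y Ky; have [c [d [[cy yd] cdK]]] := fin_isolated y (fK (upd v i x)).
  have [q] := rat_in_itvoo cy; rewrite in_itv /= => /andP[cq qy].
  have [q'] := rat_in_itvoo yd; rewrite in_itv /= => /andP[yq' q'd].
  exists (ratr q), (ratr q'); split=> //.
  apply: near_upd_locc; last exact: (Hx (true, (q, q'))).
  exists y; split; first by split; lra.
  by split=> // t qt tq' Kt; apply: cdK => //; lra.
- move=> z z' He; have [zz'|z'z] := leP z z'; last first.
    by apply: near_upd_all => w t; lra.
  (* As [K] is finite there, the empty window [z, z'] can be enlarged to one with rational ends. *)
  have [c [d [[cz zd] cdK]]] := fin_isolated z (fK (upd v i x)).
  have [c' [d' [[cz' zd'] cdK']]] := fin_isolated z' (fK (upd v i x)).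
  have [q] := rat_in_itvoo cz; rewrite in_itv /= => /andP[cq qz].
  have [q'] := rat_in_itvoo zd'; rewrite in_itv /= => /andP[zq' q'd].
  have : near_upd i (upd v i x) (fun w => empty K w (ratr q) (ratr q')).
    apply: near_upd_locc; last exact: (Hx (false, (q, q'))).
    move=> t qt tq' Kt; have [tz|zt] := ltP t z.
      by have := cdK t _ _ Kt; lra.
    have [tz'|zt'] := leP t z'; first exact: (He t).
    by have := cdK' t _ _ Kt; lra.
  by apply: near_upd_sub => w Hw t zt tz'; apply: Hw; lra.
- exists n%:R; exists a2, b2; rewrite updE; split=> // y ay yb.
  by rewrite upd_upd; apply: Hn; lra.
- exists (- m%:R); exists a2, b2; rewrite updE; split=> // y ay yb.
  by rewrite upd_upd; apply: Hm; lra.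
Qed.

End LocalCount.

Section UniformFiniteness.
Context {L : language} {R : realType} (M : expansion L R).
Hypothesis oM : o_minimal M.
Implicit Types (v w : nat -> R) (K : (nat -> R) -> R -> Prop) (V W : seq nat).

Lemma dep_upd T W i (P : (nat -> R) -> T) a :
  dep (i :: W) P -> dep W (fun v => P (upd v i a)).
Proof.
move=> dP v w vw; apply: dP => j; rewrite inE /upd.
by case: eqP => //= _ /vw.
Qed.

Lemma dep_upd_filter T V i (P : (nat -> R) -> T) a :
  dep V P -> dep [seq j <- V | j != i] (fun v => P (upd v i a)).
Proof.
move=> dP v w vw; apply: dP => j jV; rewrite /upd.
by case: eqP => // /eqP ji; apply: vw; rewrite mem_filter /= ji.
Qed.

Lemma size_filter_neq V i :
  i \in V -> (size [seq j <- V | j != i] < size V)%N.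
Proof.
move=> iV; rewrite -(count_predC (predC1 i) V) size_filter.
by rewrite -addn1 leq_add2l -has_count; apply/hasP; exists i; rewrite //= eqxx.
Qed.

Lemma dep_sub T V W (P : (nat -> R) -> T) :
  {subset V <= W} -> dep V P -> dep W P.
Proof. by move=> VW dP v w vw; apply: dP => i /VW/vw. Qed.

Lemma near_upd_dep V i v w P : dep V P -> i \in V ->
  (forall j, j \in V -> v j = w j) -> near_upd i v P -> near_upd i w P.
Proof.
move=> dP iV vw [a [b [[av vb] H]]]; exists a, b; rewrite -vw //; split=> // x ax xb.
rewrite -(dP (upd v i x)); first exact: H.
by move=> j jV; rewrite /upd; case: eqP => // _; exact: vw.
Qed.

Lemma good_dep V K i : dep V K -> i \in V -> dep V (good K i).
Proof.
move=> dK iV.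
suff H v w : (forall j, j \in V -> v j = w j) -> good K i v -> good K i w.
  by move=> v w vw; apply/propext; split; apply: H => // j /vw.
move=> vw; rewrite /good /empty (dK v w vw) => -[h1 [h2 [[z3 h3] [z4 h4]]]].
have nu P : dep V P -> near_upd i v P -> near_upd i w P.
  by move=> dP; exact: near_upd_dep dP iV vw.
do ?split.
- move=> y /h1[z [z' [yz h]]]; exists z, z'; split=> //; apply: nu h.
  by move=> u u' uu; rewrite /single (dK u u' uu).
- move=> z z' /h2; apply: nu.
  by move=> u u' uu; rewrite (dK u u' uu).
- by exists z3; apply: nu h3 => u u' uu; rewrite (dK u u' uu).
- by exists z4; apply: nu h4 => u u' uu; rewrite (dK u u' uu).
Qed.

Lemma near_upd_comp i j v a P : i != j ->
  near_upd j (upd v i a) P -> near_upd j v (fun w => P (upd w i a)).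
Proof.
move=> ij [c [d [cd H]]]; exists c, d; split.
  by move: cd; rewrite /upd eq_sym (negbTE ij).
by move=> x cx xd; rewrite updC 1?eq_sym //; exact: H.
Qed.

(** The component of the complement of a finite [K v] that has [t] elements of [K v] to its left. *)
Definition piece t K v a := stage t (K v) a /\ ~ K v a.

Lemma piece_dfn t K : dfn2 M K -> dfn2 M (piece t K).
Proof. by move=> dK; rewrite /piece; solve_dfn. Qed.

Lemma piece_dep V t K : dep V K -> dep V (piece t K).
Proof. by move=> dK v w vw; rewrite /piece (dK v w vw). Qed.

Lemma piece_const t K v a b (A : R -> Prop) :
  (forall x, ~ K v x -> locc A x) -> piece t K v a -> piece t K v b ->
  (A a <-> A b).
Proof.
move=> KA.
suff H a' b' : a' < b' -> piece t K v a' -> piece t K v b' -> (A a' <-> A b').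
  move=> pa pb; have [ab|ba|->//] := ltgtP a b; first exact: H.
  by have := H b a ba pb pa; tauto.
move=> ab [sa Ka] [sb Kb]; apply: locc_const => // x ax xb; apply: KA.
by have [] := stage_conv sa sb Kb ax xb.
Qed.

Definition bounded K := exists k, forall v z, ~ below k (K v) z.

(* [G k v] stands for "n(v) >= k", where n takes values in nat but need not be
   definable.  Along the i-th lines n is constant on the pieces cut out by the
   bad points; its value on the t-th piece is a function of the other
   variables, to which induction applies. *)
Lemma bounded_of_good m
  (UF : forall V K, (size V < m)%N -> dfn2 M K -> dep V K ->
    (forall v, fin (K v)) -> bounded K) :
  forall W (G : nat -> (nat -> R) -> Prop) (Gd : nat -> (nat -> R) -> Prop),
  (size W <= m)%N -> uniq W ->
  (forall k, dfn M (G k)) -> (forall k, dep W (G k)) ->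
  (forall k v, G k.+1 v -> G k v) -> (forall v, exists k, ~ G k v) ->
  (forall i, i \in W -> dfn M (Gd i)) -> (forall i, i \in W -> dep W (Gd i)) ->
  (forall i v, i \in W -> Gd i v -> forall k,
     near_upd i v (fun w => G k w <-> G k v)) ->
  (forall i v, i \in W -> fin (fun a => ~ Gd i (upd v i a))) ->
  (forall i Q, i \in W -> dfn M Q -> dep W Q ->
     (forall v, fin (fun a => Q (upd v i a))) ->
     exists k, forall v, Q v -> ~ G k v) ->
  exists k, forall v, ~ G k v.
Proof.
elim=> [|i W IH] G Gd sW uW dG depG G1 Gf dGd depGd locG finG QG.
  have [k nG] := Gf (fun=> 0); exists k => v.
  by rewrite (depG k v (fun=> 0)).
have iW : i \in i :: W by rewrite mem_head.
move: uW => /= /andP[niW uW].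
have Gle k k' v : (k <= k')%N -> G k' v -> G k v.
  by move=> /subnK <-; elim: (k' - k)%N => // n IHn; rewrite addSn => /G1.
pose B v a := ~ Gd i (upd v i a).
have dB : dfn2 M B by have := dGd i iW; rewrite /B => ?; solve_dfn.
have depB : dep W B.
  by move=> v w vw; apply/funext => a; rewrite /B (dep_upd a (depGd i iW) vw).
have fB v : fin (B v) by exact: finG.
have [k0 Bk0] := UF W B sW dB depB fB.
have [kQ GQ] : exists k, forall v, ~ Gd i v -> ~ G k v.
  apply: (QG i) => //; first exact/dfn_not/dGd.
  by move=> v w vw; rewrite (depGd i iW v w vw).
have cst t v k a b : piece t B v a -> piece t B v b ->
    G k (upd v i a) -> G k (upd v i b).
  move=> pa pb; apply: (piece_const (A := fun x => G k (upd v i x)) _ pa pb).1.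
  move=> x /contrapT gx; have [c [d [cd H]]] := locG i _ iW gx k.
  rewrite updE in cd; exists c, d; split=> // y cy yd.
  by have := H y cy yd; rewrite upd_upd.
have dp t := piece_dfn t dB.
have depp t := piece_dep t depB.
have fp t v a : piece t B v a -> exists c d, (c < a /\ a < d) /\
    forall x, c < x -> x < d -> piece t B v x.
  by move=> [sa na]; exact: stage_open.
have BE v : B v = fun a => ~ Gd i (upd v i a) by [].
clearbody B.
have /choice[kt ktP] t : exists k, forall v, ~ exists a,
    piece t B v a /\ G k (upd v i a).
  (* The value of n on the t-th piece, as a function of the remaining variables; it is 0 or less
     where the piece is empty, in that no [G' k] holds. *)
  pose G' k v := exists a, piece t B v a /\ G k (upd v i a).
  (* Along the j-th line, either the piece stays empty, or one fixed [a] stays in it at which [G] is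
     locally constant. *)
  pose Gd' j v := near_upd j v (fun w => ~ exists a, piece t B w a) \/
    exists a, Gd j (upd v i a) /\ near_upd j v (fun w => piece t B w a).
  have dG' j : j \in W -> dfn M (Gd' j).
    move=> jW; have dj : dfn M (Gd j) by apply: dGd; rewrite inE jW orbT.
    by have dpt := dp t; rewrite /Gd' /near_upd; solve_dfn.
  have jiW j : j \in W -> j \in i :: W by rewrite inE => ->; rewrite orbT.
  have ij j : j \in W -> i != j by move=> jW; apply/eqP => E; rewrite E jW in niW.
  apply: (IH G' Gd') => //.
  - exact: ltnW.
  - by move=> k; have dpt := dp t; have dGk := dG k; rewrite /G'; solve_dfn.
  - move=> k v w vw; rewrite /G' (depp t v w vw); congr (ex _).
    by apply/funext => a; rewrite (dep_upd a (depG k) vw).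
  - by move=> k v [a [pa /G1]]; exists a.
  - move=> v; have [[a pa]|nE] := pselect (exists a, piece t B v a); last first.
      by exists 0%N => -[a [pa _]]; apply: nE; exists a.
    have [k nk] := Gf (upd v i a); exists k => -[b [pb]] /(cst _ _ _ _ _ pb pa).
    exact: nk.
  - move=> j jW.
    suff H v w : (forall j, j \in W -> v j = w j) -> Gd' j v -> Gd' j w.
      by move=> v w vw; apply/propext; split; apply: H => // l /vw.
    move=> vw [h|[a [ga h]]]; [left|right].
      by apply: (near_upd_dep _ jW vw h) => u u' uu; rewrite (depp t u u' uu).
    exists a; split; first by rewrite -(dep_upd a (depGd j (jiW _ jW)) vw).
    by apply: (near_upd_dep _ jW vw h) => u u' uu; rewrite (depp t u u' uu).
  - move=> j v jW [h k|[a [ga h]] k].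
      have nv := near_upd_self h.
      by apply: near_upd_sub h => w nw; split=> -[a [pa _]];
        [case: nw|case: nv]; exists a.
    have h' := near_upd_comp (ij _ jW) (locG j _ (jiW _ jW) ga k).
    have pv := near_upd_self h.
    apply: near_upd_and h h' => w pw E; split=> -[b [pb Gb]]; exists a; split=> //;
      by apply/E; exact: cst pb _ Gb.
  - move=> j v jW; have dj := dG' j jW.
    apply: nonfin_hasint; first by solve_tame oM.
    move=> [a [b [ab H]]]; have dpt := dp t.
    (* On a subinterval of a supposed interval of bad points, the piece is always empty or never
       empty; the first case is good by definition. *)
    have [||a' [b' [aa' ab' b'b]]] := @tame_subint _
      (fun x => exists a, piece t B (upd v j x) a) a b => //.
      by solve_tame oM.
    case=> H'; last first.
      case: (H ((a' + b') / 2)); [lra|lra|]; left; exists a', b'.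
      by rewrite updE; split=> [|x ax xb]; [lra|rewrite upd_upd; exact: H'].
    (* Nonempty pieces are open, so one rational [q] lies in the pieces over a whole subinterval.
       Avoiding the finitely many bad points at level [q] yields a good point. *)
    have [||q [c [d [ac cd db Hq]]]] := tame_cover
      (A := fun (q : rat) x => piece t B (upd v j x) (ratr q)) ab'.
    + by move=> q; solve_tame oM.
    + move=> x ax xb; have [y py] := H' x ax xb.
      have [e [f [[ey yf] ef]]] := fp _ _ _ py.
      have [q] := rat_in_itvoo ey; rewrite in_itv /= => /andP[eq qy].
      by exists q; apply: ef; lra.
    have [s sP] := finG j (upd v i (ratr q)) (jiW _ jW).
    have [c' [d' [cc' cd' dd' sc]]] := seq_avoid s cd.
    have [x [cx xd]] : exists x, c' < x /\ x < d'.
      by exists ((c' + d') / 2); lra.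
    apply: (H x); [lra|lra|]; right; exists (ratr q); split.
      rewrite updC 1?eq_sym ?ij //; apply: contrapT => /sP/sc; lra.
    exists c, d; rewrite updE; split=> [|y cy yd]; first lra.
    by rewrite upd_upd; exact: Hq.
  - move=> j Q jW dQ depQ fQ.
    have [||||k kP] := QG j Q => //; first exact: jiW.
      by apply: dep_sub depQ => l; exact: jiW.
    exists k => v Qv [a [_]]; apply: kP.
    rewrite (depQ _ v) // => l lW; rewrite /upd; case: eqP => // E.
    by rewrite -E lW in niW.
(* Bad points are bounded by [kQ]; a good point lies on the t-th piece of its line for some t < k0
   and is bounded by [kt t]. *)
exists (maxn kQ (\max_(t < k0) kt t)) => v Gv.
have [g|ng] := pselect (Gd i v); last first.
  by apply: (GQ v ng); apply: Gle Gv; rewrite leq_maxl.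
have nB : ~ B v (v i) by rewrite BE upd_id => /(_ g).
have [t tk st] := stageP (Bk0 v (v i)).
apply: (ktP t v); exists (v i); split; first by split.
rewrite upd_id; apply: Gle Gv; rewrite leq_max orbC.
by rewrite (leq_bigmax (F := fun t : 'I_k0 => kt t) (Ordinal tk)).
Qed.

Lemma fin_bigcup (A : R -> Prop) (B : R -> R -> Prop) : fin A ->
  (forall a, fin (B a)) -> fin (fun z => exists a, A a /\ B a z).
Proof.
move=> [s sA] /choice[f fB]; exists (flatten (map f s)) => z [a [/sA sa /fB fa]].
by apply/flattenP; exists (f a) => //; exact: map_f.
Qed.

(** [bounded_of_good] is applied to the number of elements of [K v]. Over a set [Q] with finite i-th
    lines, the union of [K] along each line is still finite and depends on fewer variables; its
    bound bounds [K] on [Q]. *)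
Theorem uniform_finiteness V K : dfn2 M K -> dep V K -> (forall v, fin (K v)) ->
  bounded K.
Proof.
have [n] := ubnP (size V); elim: n V K => // n IH V K; rewrite ltnS => sV dK depK fK.
have {}depK : dep (undup V) K by apply: dep_sub depK => j; rewrite mem_undup.
have {}sV : (size (undup V) <= n)%N by exact: leq_trans (size_undup _) sV.
have := undup_uniq V; move: (undup V) depK sV => {}V depK sV uV.
have [|||||||||||k kP] := @bounded_of_good (size V)
    (fun V' K' sV' => IH V' K' (leq_trans sV' sV)) V
    (fun k => count_ge k K) (fun i => good K i) => //.
- by move=> k; rewrite /count_ge; solve_dfn.
- by move=> k v w vw; rewrite /count_ge (depK v w vw).
- by move=> k v [z /(below_leq (leqnSn k)) H]; exists z.
- by move=> v; have [k kP] := fin_below (fK v); exists k => -[z]; exact: kP.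
- by move=> i iV; exact: good_dfn.
- by move=> i; exact: good_dep.
- by move=> i v iV gK k; exact: good_count.
- by move=> i v iV; exact: (good_cofinite oM i v dK fK).
- move=> i Q iV dQ depQ fQ.
  pose K' v z := exists a, Q (upd v i a) /\ K (upd v i a) z.
  have [||||k kP] := IH [seq j <- V | j != i] K'.
  + by apply: leq_trans sV; exact: size_filter_neq.
  + by rewrite /K'; solve_dfn.
  + move=> v w vw; apply/funext => z; rewrite /K'; congr (ex _).
    apply/funext => a; congr and; first exact: (dep_upd_filter a depQ vw).
    by rewrite (dep_upd_filter a depK vw).
  + by move=> v; exact: fin_bigcup.
  exists k => v Qv [z /below_sub Kz]; apply: (kP v z); apply: Kz => x Kx.
  by exists (v i); rewrite upd_id.
by exists k => v z H; apply: (kP v); exists z.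
Qed.

End UniformFiniteness.

(** * Definability of 1-types *)

Section Ultrafilters.
Context {T : Type} (U : set_system T) {uU : UltraFilter U}.

Lemma ultraN (P : T -> Prop) : U [set t | ~ P t] <-> ~ U [set t | P t].
Proof.
split=> [H H'|nP].
  by have [t []] := filter_ex (filterI H H').
by have [|] := in_ultra_setVsetC [set t | P t] uU.
Qed.

Lemma ultraI (P Q : T -> Prop) :
  U [set t | P t /\ Q t] <-> U [set t | P t] /\ U [set t | Q t].
Proof.
split=> [H|[H H']]; last exact: filterI H H'.
by split; apply: filterS H => t [].
Qed.

Lemma ultraU (P Q : T -> Prop) :
  U [set t | P t \/ Q t] <-> U [set t | P t] \/ U [set t | Q t].
Proof.
have -> : [set t | P t \/ Q t] = [set t | ~ (~ P t /\ ~ Q t)].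
  by apply/funext => t; apply/propext => /=; rewrite not_andP !notK.
by rewrite ultraN ultraI !ultraN not_andP !notK.
Qed.

Lemma ultra_cst (P : Prop) : U [set t | P] <-> P.
Proof.
split=> [/filter_ex[]//|p].
by apply: filterS (@filterT _ U _).
Qed.

End Ultrafilters.

Section DefinableOneTypes.
Context {L : language} {R : realType} (M : expansion L R).
Hypothesis oM : o_minimal M.

(** The sets [J s] form a base for the definable part of the image of [U]: every tame set contains
    or misses one of them. Membership in [U] thus becomes a first-order inclusion. *)
Lemma dfn_germ {T : Type} (U : set_system T) {uU : UltraFilter U} (f : T -> R)
    (S : R -> Prop) (J : R -> R -> Prop) (K : (nat -> R) -> R -> Prop) :
  dfn M (fun v => S (v 0%N)) -> dfn M (fun v => J (v 0%N) (v 1%N)) ->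
  (forall s, S s -> U [set t | J s (f t)]) ->
  (forall A, tame A -> exists s, S s /\
     ((forall t, J s t -> A t) \/ (forall t, J s t -> ~ A t))) ->
  dfn2 M K -> dfn M (fun v => U [set t | K v (f t)]).
Proof.
move=> dS dJ SU SA dK.
apply: (dfn_iff (P := fun v => exists s, S s /\ forall t, J s t -> K v t)).
  move=> v; split=> [[s [Ss H]]|UK].
    by apply: filterS (SU s Ss) => t; exact: H.
  have [|s [Ss [H|H]]] := SA (K v); [by solve_tame oM|by exists s|].
  by have [t [/H]] := filter_ex (filterI (SU s Ss) UK).
pose S' (u : nat -> R) := S (u 0%N); pose J' (u : nat -> R) := J (u 0%N) (u 1%N).
apply: (dfn_iff (P := fun v => exists s, S' (fun=> s) /\
  forall t, J' (fun j => if j == 0%N then s else t) -> K v t)) => //.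
have dS' : dfn M S' by []; have dJ' : dfn M J' by [].
by clearbody S' J'; solve_dfn.
Qed.

Lemma seq_lb (s : seq R) : exists m, forall x, x \in s -> m < x.
Proof.
elim: s => [|y s [m mP]]; first by exists 0.
exists (Num.min m (y - 1)) => x; rewrite inE gt_min => /orP[/eqP->|/mP ->//].
by rewrite orbC; apply/orP; left; lra.
Qed.

Lemma seq_ub (s : seq R) : exists m, forall x, x \in s -> x < m.
Proof.
elim: s => [|y s [m mP]]; first by exists 0.
exists (Num.max m (y + 1)) => x; rewrite inE lt_max => /orP[/eqP->|/mP ->//].
by rewrite orbC; apply/orP; left; lra.
Qed.

(* By completeness of R, an ultrafilter on R concentrates at a point, on one
   side of a point, or at an infinite end, and o-minimality makes the germ of
   a definable set there constant. *)
Lemma dfn_ultra1 {T : Type} (U : set_system T) {uU : UltraFilter U}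
    (f : T -> R) (K : (nat -> R) -> R -> Prop) :
  dfn2 M K -> dfn M (fun v => U [set t | K v (f t)]).
Proof.
move=> dK.
pose E := [set s | U [set t | s < f t]].
have nE s : ~ E s -> U [set t | f t <= s].
  move=> nEs; apply: filterS ((ultraN (fun t => s < f t)).2 nEs) => t /= /negP.
  by rewrite -leNgt.
(* If [E] is empty, [U] tends to minus infinity. *)
have [E0|/eqP/set0P nE0] := pselect (E = set0).
  apply: (dfn_germ (f := f) (S := fun=> True) (J := fun s t => t < s)) => //.
  - by solve_dfn.
  - by solve_dfn.
  - move=> s _; have : ~ E (s - 1) by rewrite E0.
    by move=> /nE H; apply: filterS H => t /=; lra.
  - move=> A [s sA]; have [m mP] := seq_lb s; exists m; split=> //.
    have H t : t < m -> (A t <-> A (m - 1)).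
      move=> tm; have [h|h|->//] := ltgtP t (m - 1).
        by apply: sA => // x /mP; right; lra.
      by rewrite (sA _ _ h) // => x /mP; right; lra.
    have [Am|nAm] := pselect (A (m - 1)); [left|right] => t /H; tauto.
(* If [E] is unbounded, [U] tends to plus infinity. *)
have [hE|nhE] := pselect (has_sup E); last first.
  have ET s : E s.
    apply: contrapT => /nE H; apply: nhE; split=> //; exists s => x xE.
    rewrite leNgt; apply/negP => sx.
    by have [t /=] := filter_ex (filterI H xE); lra.
  apply: (dfn_germ (f := f) (S := fun=> True) (J := fun s t => s < t)) => //.
  - by solve_dfn.
  - by solve_dfn.
  - by move=> s _; exact: ET.
  - move=> A [s sA]; have [m mP] := seq_ub s; exists m; split=> //.
    have H t : m < t -> (A t <-> A (m + 1)).
      move=> tm; have [h|h|->//] := ltgtP t (m + 1).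
        by apply: sA => // x /mP; left; lra.
      by rewrite (sA _ _ h) // => x /mP; left; lra.
    have [Am|nAm] := pselect (A (m + 1)); [left|right] => t /H; tauto.
set r := sup E.
have Er s : E s -> s <= r by move=> Es; apply: sup_upper_bound.
(* Otherwise [U] lies immediately right of [r], immediately left of [r], or at [r] itself, in this
   order. *)
have [Ur|/(ultraN (fun t => r < f t)).2 nUr] := pselect (U [set t | r < f t]).
  apply: (dfn_germ (f := f) (S := fun s => r < s) (J := fun s t => r < t /\ t < s)) => //.
  - by solve_dfn.
  - by solve_dfn.
  - move=> s rs; set m := (r + s) / 2.
    have : ~ E m by move=> /Er; rewrite /m; lra.
    move=> /nE H; apply: filterS (filterI Ur H) => t [/=] h1 h2; split=> //.
    by move: h2; rewrite /m; lra.
  - move=> A [s sA]; have [a [b [[ar rb] abs]]] := seq_gap s r.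
    exists b; split=> //.
    have [|H|H] := @tame_const _ A s r b sA.
    + by move=> x xs rx xb; have := abs x xs; lra.
    + by left=> t [? ?]; exact: H.
    + by right=> t [? ?]; exact: H.
have [Ur|/(ultraN (fun t => f t < r)).2 nUr'] := pselect (U [set t | f t < r]).
  apply: (dfn_germ (f := f) (S := fun s => s < r) (J := fun s t => s < t /\ t < r)) => //.
  - by solve_dfn.
  - by solve_dfn.
  - move=> s sr; have [e Ee se] := sup_gt nE0 sr.
    by apply: filterS (filterI Ur Ee) => t [/=] h1 h2; split=> //; lra.
  - move=> A [s sA]; have [a [b [[ar rb] abs]]] := seq_gap s r.
    exists a; split=> //.
    have [|H|H] := @tame_const _ A s a r sA.
    + by move=> x xs rx xb; have := abs x xs; lra.
    + by left=> t [? ?]; exact: H.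
    + by right=> t [? ?]; exact: H.
apply: (dfn_germ (f := f) (S := fun=> True) (J := fun s t => t = r)) => //.
- by solve_dfn.
- by solve_dfn.
- move=> s _; apply: filterS (filterI nUr nUr') => t [/= /negP + /negP].
  by rewrite -!leNgt => ? ?; lra.
- move=> A _; exists 0; split=> //.
  by have [Ar|nAr] := pselect (A r); [left|right] => t ->.
Qed.

End DefinableOneTypes.

(** * Cuts of definable preorders *)

Section Cuts.
Context {L : language} {R : realType} (M : expansion L R).
Hypothesis oM : o_minimal M.
Implicit Types (v w b : nat -> R) (V W : seq nat) (P D : (nat -> R) -> Prop).
Implicit Types (le : (nat -> R) -> (nat -> R) -> Prop).

Lemma dfn_exlt k (P : nat -> (nat -> R) -> Prop) :
  (forall t, dfn M (P t)) -> dfn M (fun v => exists2 t, (t < k)%N & P t v).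
Proof.
move=> dP; elim: k => [|k IH].
  by apply: (dfn_iff _ (dfn_const M False)) => v; split=> // -[].
apply: (dfn_iff _ (dfn_or (dP k) IH)) => v; split=> [[Pk|[t tk Pt]]|[t]].
- by exists k.
- by exists t => //; exact: ltnW.
- by rewrite ltnS leq_eqVlt => /orP[/eqP->|tk]; [left|right; exists t].
Qed.

(* Iterating "contains an interval" over the variables in V defines "has
   nonempty interior" on R^V. *)
Fixpoint bigs V P v : Prop :=
  if V is i :: V' then hasint (fun a => bigs V' P (upd v i a)) else P v.

Lemma bigs_mono V P Q v : (forall b, P b -> Q b) -> bigs V P v -> bigs V Q v.
Proof.
move=> PQ; elim: V v => [|i V IH] v /=; first exact: PQ.
by move=> [a [b [ab H]]]; exists a, b; split=> // x ax xb; exact/IH/H.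
Qed.

Lemma bigs_dep V W P : dep (V ++ W) P -> dep W (bigs V P).
Proof.
elim: V W => [//|i V IH] W dP v w vw /=; congr hasint.
apply/funext => a; apply: (dep_upd a (IH (i :: W) _)) vw.
by apply: dep_sub dP => j; rewrite /= !inE !mem_cat !inE orbCA.
Qed.

Lemma bigs_const V P v w : dep V P -> bigs V P v = bigs V P w.
Proof. by move=> dP; apply: (bigs_dep (W := [::])) => //; rewrite cats0. Qed.

Lemma bigs_dfnR V (Q : (nat -> R) -> (nat -> R) -> Prop) :
  dfnR M Q -> dfnR M (fun u b => bigs V (Q u) b).
Proof.
move=> dQ; elim: V => [|i V IH] //=.
have H B : dfnR M B -> dfnR M (fun u b => hasint (fun a => B u (upd b i a))).
  by move=> dB; rewrite /hasint; solve_dfn.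
exact: H IH.
Qed.

Lemma bigs_dfn V P : dfn M P -> dfn M (bigs V P).
Proof.
move=> dP; have := @bigs_dfnR V (fun=> P); rewrite /dfnR => /(_ _)H.
have {}H : dfnR M (fun _ b => bigs V P b) by apply: H; solve_dfn.
by have := @dfnR_sub _ _ M _ id id H; apply=> j; exact: coord_var.
Qed.

(** Exchanges the order of the quantifiers one variable at a time: [tame_box] gives a box in the (y,
    t) plane, and any [t] in it serves a whole interval of [y]. *)
Lemma bigs_swap V (P : R -> (nat -> R) -> Prop) v :
  dfnR M (fun u b => P (u 0%N) b) ->
  hasint (fun y => bigs V (P y) v) -> exists b, hasint (fun y => P y b).
Proof.
move=> dP; elim: V v => [|i V IH] v /=; first by exists v.
move=> [a [b [ab H]]].
pose B (u b : nat -> R) := bigs V (P (u 0%N)) b.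
have dB : dfnR M B by exact: (bigs_dfnR V dP).
have BE y w : B (fun=> y) w = bigs V (P y) w by [].
have {}H x : a < x -> x < b -> hasint (fun t => B (fun=> x) (upd v i t)) := H x.
clearbody B.
have [|a' [b' [c [d [aa' ab' bb' cd H']]]]] := @tame_box _
    (fun y t => B (fun=> y) (upd v i t)) a b ab _ H.
  by move=> c d; solve_tame oM.
apply: (IH (upd v i ((c + d) / 2))); exists a', b'; split=> // y ay yb.
by rewrite -BE; apply: H' => //; lra.
Qed.

Definition total_preorder le :=
  (forall u v w, le u v -> le v w -> le u w) /\ (forall u v, le u v \/ le v u).

Definition cuts_dfn V := forall le D, dfnR M le -> total_preorder le ->
  dep V le -> (forall u v, le u v -> D v -> D u) -> dfn M D.

Section Step.
Variables (V : seq nat) (le : (nat -> R) -> (nat -> R) -> Prop).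
Variable (D : (nat -> R) -> Prop).
Hypotheses (dle : dfnR M le) (tle : total_preorder le) (dV : dep V le).
Hypothesis (cD : forall u v, le u v -> D v -> D u).
Hypothesis IH : forall W, (size W < size V)%N -> cuts_dfn W.

Let le_trans u v w : le u v -> le v w -> le u w.
Proof. by case: tle => + _; exact. Qed.

Let le_total u v : le u v \/ le v u.
Proof. by case: tle. Qed.

Let le_refl v : le v v.
Proof. by case: (le_total v v). Qed.

Let le_nle u v : ~ le u v -> le v u.
Proof. by case: (le_total u v). Qed.

Let le_agree v w : (forall i, i \in V -> v i = w i) -> le v w.
Proof. by move=> /(dV (v := v))->. Qed.

(** The final segments of [D] on the line generate a filter. For an ultrafilter [U] extending it, a
    point of the line is in [D] iff it is below [U]-many points, which [dfn_ultra1] makes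
    definable. *)
Lemma cut_line v i : dfn M (fun u => D (upd v i (u 0%N))).
Proof.
have [[a0 Da0]|nE] := pselect (exists a, D (upd v i a)); last first.
  apply: (dfn_iff _ (dfn_const M False)) => u; split=> // Du.
  by apply: nE; exists (u 0%N).
pose A := [set a | D (upd v i a)].
pose J e := [set t | A t /\ le (upd v i e) (upd v i t)].
have FJ : ProperFilter (filter_from A J).
  apply: filter_from_proper; last by move=> e Ae; exists e; split.
  apply: filter_from_filter; first by exists a0.
  move=> e e' Ae Ae'; have [h|h] := le_total (upd v i e) (upd v i e').
    exists e' => // t [At h']; split; split=> //; exact: le_trans h h'.
  exists e => // t [At h']; split; split=> //; exact: le_trans h h'.
have [U [UU FU]] := ultraFilterLemma FJ.
have /(dfn_ultra1 oM (U := U) id) : dfn2 M (fun u t => le (upd v i (u 0%N)) (upd v i t)).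
  by solve_dfn.
apply: dfn_iff => u; split=> [H|Du].
  have UA : U A by apply: FU; exists a0 => // t [].
  by have [t [+ At]] := filter_ex (filterI H UA); move=> /cD; apply.
by apply: FU; exists (u 0%N) => // t [].
Qed.

(** Pieces are compared by cofinality: [le' v w] when every point over [v] is below some point over
    [w]. The [v] whose whole piece lies in [D] form a cut of [le'], definable by induction, and [D]
    contains each piece entirely or not at all. *)
Lemma cut_piece W i (Z : (nat -> R) -> R -> Prop) :
  (size W < size V)%N -> (forall a, dep W (fun v => le (upd v i a))) ->
  dfn2 M Z -> dep W Z ->
  (forall v a a', Z v a -> Z v a' -> D (upd v i a) -> D (upd v i a')) ->
  dfn M (fun v => Z v (v i) /\ D v).
Proof.
move=> sW dW dZ depZ ZD.
pose C v := forall y, Z v y -> D (upd v i y).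
pose le' v w := forall y, Z v y -> exists y', Z w y' /\ le (upd v i y) (upd w i y').
have dC : dfn M C.
  apply: (IH sW (le := le')).
  - by rewrite /le'; solve_dfn.
  - split=> [u v w uv vw y /uv[y' [/vw[y'' [Zw h']] h]]|u v].
      by exists y''; split=> //; exact: le_trans h h'.
    have [|/existsNP[y /not_implyP[Zy /forallNP H]]] := pselect (le' u v); first by left.
    right=> y' Zy'; exists y; split=> //; apply: le_nle => h.
    by apply: (H y').
  - move=> v w vw; apply/funext => u; rewrite /le' (depZ v w vw).
    apply/propext; split=> H y /H[y' [Zy' h]]; exists y'; split=> //.
      by rewrite -(dW y v w vw).
    by rewrite (dW y v w vw).
  - move=> u v uv Cv y /uv[y' [/Cv Dy' h]].
    exact: cD h Dy'.
apply: (dfn_iff (P := fun v => Z v (v i) /\ C v)); last by solve_dfn.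
move=> v; split=> -[Zv].
  by move=> /(_ _ Zv); rewrite upd_id.
by move=> Dv; split=> // y Zy; apply: (ZD v (v i)) => //; rewrite upd_id.
Qed.

Lemma cut_stage i t (K : (nat -> R) -> R -> Prop) : i \in V ->
  dfn2 M K -> dep [seq j <- V | j != i] K ->
  dfn M (fun v => (stage t (K v) (v i) /\ K v (v i)) /\ D v).
Proof.
move=> iV dK depK.
apply: (cut_piece (W := [seq j <- V | j != i])
  (Z := fun v a => stage t (K v) a /\ K v a)).
- exact: size_filter_neq.
- by move=> a; exact: dep_upd_filter.
- by solve_dfn.
- by move=> v w vw; rewrite (depK v w vw).
- by move=> v a a' [sa Ka] [sa' Ka']; rewrite (stage_inj sa sa' Ka Ka').
Qed.

(** Points with [bigs V' P] but not [bigs (i :: V') P] are finitely many on each i-th line, hence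
    form finitely many graphs by uniform finiteness; [cut_stage] treats each graph. *)
Lemma cut_small V' P : {subset V' <= V} -> dfn M P -> dep V P ->
  dfn M (fun v => D v /\ P v /\ ~ bigs V' P v).
Proof.
move=> + dP depP; elim: V' => [|i V' IHV] sV /=.
  by apply: (dfn_iff _ (dfn_const M False)) => v; split=> // -[_ []].
have iV : i \in V by apply: sV; rewrite mem_head.
have {}IHV : dfn M (fun v => D v /\ P v /\ ~ bigs V' P v).
  by apply: IHV => j jV; apply: sV; rewrite inE jV orbT.
pose B := bigs V' P; pose Q v := B v /\ ~ bigs (i :: V') P v.
have dB : dfn M B by exact: bigs_dfn.
have dQ : dfn M Q by apply: dfn_and => //; apply/dfn_not/bigs_dfn.
have depQ : dep V Q.
  move=> v w vw; rewrite /Q /B.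
  rewrite (@bigs_dep V' V P _ v w vw) 1?(@bigs_dep (i :: V') V P _ v w vw) //.
    by apply: dep_sub depP => j jV; rewrite mem_cat jV orbT.
  by apply: dep_sub depP => j jV; rewrite mem_cat jV orbT.
have fQ v : fin (fun a => Q (upd v i a)).
  have [|h|h] := @tame_hasint _ (fun a => B (upd v i a)); first by solve_tame oM.
    exists [::] => a [_ []] /=.
    by move: h => [c [d [cd h]]]; exists c, d; split=> // x cx xd; rewrite upd_upd; exact: h.
  by apply: fin_sub h => a [].
pose K v a := Q (upd v i a).
have dK : dfn2 M K by rewrite /K; solve_dfn.
have depK : dep [seq j <- V | j != i] K.
  by move=> v w vw; apply/funext => a; exact: (dep_upd_filter a depQ vw).
have [k Kk] := uniform_finiteness oM dK depK fQ.
have dDQ : dfn M (fun v => exists2 t, (t < k)%N &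
    (stage t (K v) (v i) /\ K v (v i)) /\ D v).
  by apply: dfn_exlt => t; exact: cut_stage.
have dN : dfn M (fun v => ~ bigs (i :: V') P v) by apply/dfn_not/bigs_dfn.
apply: (dfn_iff _ (dfn_or (dfn_and IHV dN) (dfn_and dP dDQ))) => v.
have KE : K v (v i) = Q v by rewrite /K upd_id.
split=> [[[[Dv [Pv nb]] nB]|[Pv [t tk [[_ Kv] Dv]]]]|[Dv [Pv nb]]].
- by [].
- by do 2?split=> //; move: Kv; rewrite KE => -[].
- have [Bv|nB] := pselect (B v); last by left.
  right; split=> //; have [t tk st] := stageP (Kk v (v i)).
  by exists t => //; split=> //; split=> //; rewrite KE.
Qed.

Lemma cut_nil : V = [::] -> dfn M D.
Proof.
move=> V0; apply: (dfn_iff _ (dfn_const M (D (fun=> 0)))) => v.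
by split; apply: cD; apply: le_agree; rewrite V0.
Qed.

Lemma le_dep2 u : dep V (le u).
Proof.
move=> v w vw; apply/propext; split=> h; apply: le_trans h _; apply: le_agree => //.
by move=> j /vw.
Qed.

(** [D] is then the downward closure of its trace on the line, which is definable by [cut_line]. *)
Lemma cut_cofinal v i :
  (forall b, D b -> exists a, D (upd v i a) /\ le b (upd v i a)) -> dfn M D.
Proof.
move=> H; have := cut_line v i; pose A u := D (upd v i (u 0%N)) => dA.
have {}dA : dfn M A by [].
apply: (dfn_iff (P := fun b => exists a, A (fun=> a) /\ le b (upd v i a))).
  by move=> b; split=> [[a [Aa h]]|/H//]; exact: cD h Aa.
by clearbody A; solve_dfn.
Qed.

Lemma cut_coinitial v i :
  (forall b, ~ D b -> exists a, ~ D (upd v i a) /\ le (upd v i a) b) -> dfn M D.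
Proof.
move=> H; have := cut_line v i; pose A u := D (upd v i (u 0%N)) => dA.
have {}dA : dfn M A by [].
apply: (dfn_iff (P := fun b => ~ exists a, ~ A (fun=> a) /\ le (upd v i a) b)).
  move=> b; split=> [nE|Db [a [nA h]]].
    by apply: contrapT => /H.
  by apply: nA; exact: cD h Db.
by clearbody A; solve_dfn.
Qed.

(** Everything below [b0] is in [D] and everything above [b1] is outside; the thin interval between
    them falls under [cut_small]. *)
Lemma cut_thin b0 b1 v : D b0 -> ~ D b1 ->
  ~ bigs V (fun b => le b0 b /\ le b b1) v -> dfn M D.
Proof.
move=> Db0 nDb1 nb; pose P b := le b0 b /\ le b b1.
have dP : dfn M P by rewrite /P; solve_dfn.
have depP : dep V P.
  by move=> u w uw; rewrite /P (le_dep2 b0 uw) (dV uw).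
have dDP := @cut_small V P (fun j h => h) dP depP.
apply: (dfn_iff (P := fun b => le b b0 \/ D b /\ P b /\ ~ bigs V P b)); last first.
  by apply: dfn_or => //; solve_dfn.
move=> b; split=> [[h|[]//]|Db]; first exact: cD h Db0.
have [h|h] := le_total b b0; [by left|right; split=> //; split].
  split=> //; apply: le_nle => h'; apply: nDb1; exact: cD h' Db.
by rewrite (bigs_const b v depP).
Qed.

(* [b] lies in the closed gap, or jump, of the preorder at the point [a] of
   the line through [v] in direction [i]. *)
Definition straddles i v a b := forall t1 t2, t1 < a -> a < t2 ->
  (exists t, (t1 < t /\ t < t2) /\ le (upd v i t) b) /\
  (exists t, (t1 < t /\ t < t2) /\ le b (upd v i t)).

Definition stationary i v a := exists t1 t2, (t1 < a /\ a < t2) /\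
  forall t, t1 < t -> t < t2 -> le (upd v i t) (upd v i a) /\ le (upd v i a) (upd v i t).

(** Stationary points are excluded because they straddle their own equivalence class, which may have
    interior. The base [fun=> 0] is arbitrary: [bigs V] rebinds all coordinates that matter. *)
Definition critical i v a :=
  ~ stationary i v a /\ bigs V (straddles i v a) (fun=> 0).

Lemma critical_dfn i : dfn2 M (critical i).
Proof.
apply: dfn_and; first by rewrite /stationary; solve_dfn.
have /(bigs_dfnR V) : dfnR M (fun u b => straddles i (fun j => u j.+1) (u 0%N) b).
  by rewrite /straddles; solve_dfn.
by move=> H; apply: (dfnR_sub (T := id) (T' := fun v => (fun=> 0)) H) => j;
  [exact: coord_var|exact: coord_cst].
Qed.

(* Otherwise some [b] would straddle a whole interval of a line, on which the
   line would be constantly equivalent to [b]. *)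
Lemma critical_fin i v : fin (critical i v).
Proof.
have dK := critical_dfn i.
apply: nonfin_hasint; first by solve_tame oM.
move=> [c [d [cd H]]].
have [||b [c' [d' [cd' H']]]] := @bigs_swap V
    (fun y b => ~ stationary i v y /\ straddles i v y b) (fun=> 0).
- by rewrite /stationary /straddles; solve_dfn.
- exists c, d; split=> // x cx xd; have [ns] := H x cx xd.
  exact: bigs_mono.
(* After shrinking, each of the two comparisons of the line with [b] is constant. Straddling at the
   midpoint [m] forces both to hold, so [m] is stationary. *)
have [||c1 [d1 [cc1 cd1 dd1 H1]]] := @tame_subint _ (fun t => le (upd v i t) b) c' d' => //.
  by solve_tame oM.
have [||c2 [d2 [cc2 cd2 dd2 H2]]] := @tame_subint _ (fun t => le b (upd v i t)) c1 d1 => //.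
  by solve_tame oM.
set m := (c2 + d2) / 2.
have [cm md] : c2 < m /\ m < d2 by rewrite /m; lra.
have [ns st] := H' m (ltac:(lra)) (ltac:(lra)).
have [[t [[ct td] tb]] [t' [[ct' td'] bt']]] := st _ _ cm md.
case: H1 => H1; last by case: (H1 t) => //; lra.
case: H2 => H2; last by case: (H2 t') => //; lra.
apply: ns; exists c2, d2; split=> // s cs sd.
have [s1 s2] : c1 < s /\ s < d1 by lra.
have [m1 m2] : c1 < m /\ m < d1 by lra.
by split; apply: (@le_trans _ b); auto.
Qed.

Lemma cut_step i : i \in V -> dfn M D.
Proof.
move=> iV; apply: contrapT => nD.
(* No line is cofinal in [D], nor coinitial in its complement, since [D] would then be definable. *)
have cof v : exists b, D b /\ forall a, D (upd v i a) -> le (upd v i a) b.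
  apply: contrapT => nE; apply: nD; apply: (@cut_cofinal v i) => b Db.
  apply: contrapT => nE'; apply: nE; exists b; split=> // a Da; apply: le_nle => h.
  by apply: nE'; exists a.
have coi v : exists b, ~ D b /\ forall a, ~ D (upd v i a) -> le b (upd v i a).
  apply: contrapT => nE; apply: nD; apply: (@cut_coinitial v i) => b Db.
  apply: contrapT => nE'; apply: nE; exists b; split=> // a Da; apply: le_nle => h.
  by apply: nE'; exists a.
have dK := critical_dfn i.
have depK : dep [seq j <- V | j != i] (critical i).
  move=> v w vw; apply/funext => a.
  have E b t : le (upd v i t) b = le (upd w i t) b by rewrite (dep_upd_filter t dV vw).
  have E2 b t : le b (upd v i t) = le b (upd w i t).
    by rewrite (dep_upd_filter t (le_dep2 b) vw).
  have Es : stationary i v a = stationary i w a.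
    apply/propext; split=> -[t1 [t2 [h H]]]; exists t1, t2; split=> // t h1 h2.
      by rewrite -E -E2 -E -E2; exact: H.
    by rewrite E E2 E E2; exact: H.
  rewrite /critical Es; congr (_ /\ bigs _ _ _); apply/funext => b.
  apply/propext; split=> H t1 t2 h1 h2; have [[t [ht h]] [t' [ht' h']]] := H t1 t2 h1 h2.
    by split; [exists t; rewrite -E|exists t'; rewrite -E2].
  by split; [exists t; rewrite E|exists t'; rewrite E2].
have fK := critical_fin i.
(* Where [D] changes at [x], the line meets [D] and its complement arbitrarily near [x]. Hence every
   [b] between [b0] and [b1] straddles [x], and these form a big set by [cut_thin]. *)
have lK v x : ~ critical i v x -> locc (fun a => D (upd v i a)) x.
  move=> nK; apply: contrapT => nl; apply: nK; split.
    move=> [t1 [t2 [h H]]]; apply: nl; exists t1, t2; split=> // t h1 h2.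
    by have [h3 h4] := H t h1 h2; split=> ?; apply: cD; eassumption.
  have [b0 [Db0 b0P]] := cof v; have [b1 [nDb1 b1P]] := coi v.
  have : bigs V (fun b => le b0 b /\ le b b1) (fun=> 0).
    by apply: contrapT => /(cut_thin Db0 nDb1).
  apply: bigs_mono => b [h0 h1] t1 t2 h2 h3.
  have key (S : Prop) : (forall t t', (t1 < t /\ t < t2) -> (t1 < t' /\ t' < t2) ->
      D (upd v i t) -> ~ D (upd v i t') -> S) -> S.
    move=> HS; apply: contrapT => nS; apply: nl; exists t1, t2; split=> // y h4 h5.
    split=> h; apply: contrapT => nh; apply: nS.
      exact: (HS y x).
    exact: (HS x y).
  apply: key => t t' ht ht' Dt Dt'; split; [exists t|exists t']; split=> //.
    by apply: le_trans h0; exact: b0P.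
  by apply: le_trans h1 _; exact: b1P.
have [k Kk] := uniform_finiteness oM dK depK fK.
apply: nD.
(* On the t-th critical points, and on the t-th pieces between them, [D] reduces to a cut in the
   other variables. *)
pose Dt t v := (stage t (critical i v) (v i) /\ critical i v (v i)) /\ D v \/
  piece t (critical i) v (v i) /\ D v.
have dDt t : dfn M (Dt t).
  apply: dfn_or; first exact: cut_stage.
  apply: (cut_piece (W := [seq j <- V | j != i])).
  - exact: size_filter_neq.
  - by move=> a; exact: dep_upd_filter.
  - exact: piece_dfn.
  - exact: piece_dep.
  - by move=> v a a' pa pa'; rewrite (piece_const (lK v) pa pa').
apply: (dfn_iff _ (dfn_exlt k dDt)) => v; split=> [[t _ [[]|[]]]//|Dv].
have [t tk st] := stageP (Kk v (v i)); exists t => //.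
by have [Kv|nK] := pselect (critical i v (v i)); [left|right].
Qed.

End Step.

Theorem definable_cuts V : cuts_dfn V.
Proof.
have [n] := ubnP (size V); elim: n V => // n IH V; rewrite ltnS => sV le D dle tle dV cD.
have IHV W : (size W < size V)%N -> cuts_dfn W.
  by move=> WV; apply: IH; exact: leq_trans WV sV.
case: V sV dV IHV => [|i V] sV dV IHV; first exact: (cut_nil tle dV cD).
exact: (cut_step dle tle dV cD IHV (mem_head i V)).
Qed.

End Cuts.

(** The first [n] coordinates are the variables of a type, the others its parameters. *)
Definition mix (T : Type) n (x v : nat -> T) : nat -> T :=
  fun j => if (j < n)%N then x j else v j.

Lemma mixS (T : Type) n (x v : nat -> T) : mix n.+1 x v = upd (mix n x v) n (x n).
Proof.
apply/funext => j; rewrite /mix /upd ltnS leq_eqVlt.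
by case: eqP => [->|].
Qed.

(** * Definability of types *)

Section DefinableTypes.
Context {L : language} {R : realType} (M : expansion L R).
Hypothesis oM : o_minimal M.
Context {T : Type} (U : set_system T) {uU : UltraFilter U} (x : T -> nat -> R).

Let dfn_mix n (P : (nat -> R) -> Prop) :=
  dfn M (fun v => U [set t | P (mix n (x t) v)]).

Let dfn_mix_iff n (P Q : (nat -> R) -> Prop) :
  (forall w, P w <-> Q w) -> dfn_mix n P -> dfn_mix n Q.
Proof.
by move=> PQ; apply: dfn_iff => v; split; apply: filterS => t /PQ.
Qed.

Let dfn_mix_not n (P : (nat -> R) -> Prop) :
  dfn_mix n P -> dfn_mix n (fun w => ~ P w).
Proof.
move=> dP; apply: (dfn_iff _ (dfn_not dP)) => v.
by rewrite (ultraN (fun t => P (mix n (x t) v))).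
Qed.

Let dfn_mix_and n (P Q : (nat -> R) -> Prop) :
  dfn_mix n P -> dfn_mix n Q -> dfn_mix n (fun w => P w /\ Q w).
Proof.
move=> dP dQ; apply: (dfn_iff _ (dfn_and dP dQ)) => v.
by rewrite (ultraI (fun t => P (mix n (x t) v)) (fun t => Q (mix n (x t) v))).
Qed.

Let dfn_mix_or n (P Q : (nat -> R) -> Prop) :
  dfn_mix n P -> dfn_mix n Q -> dfn_mix n (fun w => P w \/ Q w).
Proof.
move=> dP dQ; apply: (dfn_iff _ (dfn_or dP dQ)) => v.
by rewrite (ultraU (fun t => P (mix n (x t) v)) (fun t => Q (mix n (x t) v))).
Qed.

Let dfn_mix_exlt n k (P : nat -> (nat -> R) -> Prop) :
  (forall t, dfn_mix n (P t)) ->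
  dfn_mix n (fun w => exists2 t, (t < k)%N & P t w).
Proof.
move=> dP; elim: k => [|k IH].
  apply: (dfn_iff _ (dfn_const M False)) => v; split=> //.
  by move=> /filter_ex[t []].
apply: (dfn_mix_iff _ (dfn_mix_or (dP k) IH)) => v; split=> [[Pk|[t tk Pt]]|[t]].
- by exists k.
- by exists t => //; exact: ltnW.
- by rewrite ltnS leq_eqVlt => /orP[/eqP->|tk]; [left|right; exists t].
Qed.

(* The fibres of S in the variable n are up-closed, hence totally preordered
   by inclusion, and the parameters in question form a cut of this preorder. *)
Let dfn_mix_ray n (S : (nat -> R) -> Prop) :
  (forall P, dfn M P -> dfn_mix n P) -> dfn M S ->
  (forall w a, w n < a -> S w -> S (upd w n a)) -> dfn_mix n.+1 S.
Proof.
move=> IH dS Sup.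
have [N depS] := dfn_local dS.
(* Reverse inclusion of fibres, [U]-almost everywhere: parameters whose fibre contains the last
   coordinate of the type are closed downwards. *)
pose le v v' := U [set t | forall a, S (upd (mix n (x t) v') n a) ->
                                     S (upd (mix n (x t) v) n a)].
apply: (definable_cuts oM (V := iota 0 N) (le := le)).
- pose P w := forall a,
    S (upd (fun j => if (j < n)%N then w j else w (n + j.*2.+1)%N) n a) ->
    S (upd (fun j => if (j < n)%N then w j else w (n + j.*2)%N) n a).
  have dP : dfn M P by rewrite /P; solve_dfn.
  have dU := IH P dP; rewrite /dfn_mix in dU.
  have := dfn_sub (T := fun u j => u (j - n)%N) dU (fun j => coord_var _).
  apply: dfn_iff => u; rewrite /le.
  set A := [set t | _]; set B := [set t | _]; suff -> : A = B by [].
  rewrite /A /B; apply/funext => t; rewrite /P /=.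
  have E c : (fun j => if (j < n)%N then mix n (x t) (fun j => u (j - n)%N) j
      else mix n (x t) (fun j => u (j - n)%N) (n + c j)%N) =
      mix n (x t) (fun j => u (c j)).
    apply/funext => j; rewrite /mix.
    by rewrite [(n + c j < n)%N]ltnNge leq_addr /= addKn; case: ltnP.
  by rewrite (E (fun j => j.*2.+1)) (E double).
- split=> [u v w uv vw|u v].
    by apply: filterS (filterI uv vw) => t [h h'] a /h'/h.
  (* For each [t] the two fibres are up-closed, hence comparable; the ultrafilter selects one of the
     two inclusions. *)
  apply/(ultraU (fun t => forall a, S (upd (mix n (x t) v) n a) ->
                                    S (upd (mix n (x t) u) n a))).
  apply: filterS (@filterT _ U _) => t _ /=.
  have [|/existsNP[a /not_implyP[Sv nSu]]] := pselect (forall a,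
    S (upd (mix n (x t) v) n a) -> S (upd (mix n (x t) u) n a)); first by left.
  right=> b Sub; have [ab|ba|<-//] := ltgtP a b.
    by have := Sup (upd (mix n (x t) v) n a) b; rewrite updE upd_upd; exact.
  by case: nSu; have := Sup (upd (mix n (x t) u) n b) a; rewrite updE upd_upd; exact.
- move=> v w vw; apply/funext => u; rewrite /le.
  set A := [set t | _]; set B := [set t | _]; suff -> : A = B by [].
  rewrite /A /B; apply/funext => t.
  have E a : S (upd (mix n (x t) v) n a) = S (upd (mix n (x t) w) n a).
    apply: depS => j jN; rewrite /upd /mix; case: eqP => // _.
    by case: ifP => // _; exact: vw.
  by apply/propext; split=> H a; [rewrite -E|rewrite E]; exact: H.
- move=> u v uv Dv; apply: filterS (filterI uv Dv) => t [/=].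
  by rewrite !mixS => H; exact: H.
Qed.

(** Induction on [n]. The last coordinate is located among the boundary points [K w] of its fibre,
    of which there are boundedly many; [P] becomes a Boolean combination of conditions with
    up-closed fibres and conditions free of that coordinate. *)
Theorem dfn_ultra n (P : (nat -> R) -> Prop) : dfn M P ->
  dfn M (fun v => U [set t | P (mix n (x t) v)]).
Proof.
rewrite -/(dfn_mix n P); elim: n P => [|n IH] P dP.
  by apply: dfn_iff dP => v; exact: iff_sym (ultra_cst (P v)).
have ind Q : dfn M Q -> (forall w a, Q (upd w n a) = Q w) -> dfn_mix n.+1 Q.
  move=> dQ Qn; apply: dfn_iff (IH Q dQ) => v.
  by split; apply: filterS => t /=; rewrite mixS Qn.
pose K w z := ~ locc (fun a => P (upd w n a)) z.
have dK : dfn2 M K by rewrite /K /locc; solve_dfn.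
have Kn w a : K (upd w n a) = K w.
  by apply/funext => z; rewrite /K; congr (~ locc _ _); apply/funext => b; rewrite upd_upd.
have fK w : fin (K w) by apply: tame_locc; solve_tame oM.
have [N depP] := dfn_local dP.
have depK : dep (iota 0 N) K.
  move=> v w vw; apply/funext => z; rewrite /K; congr (~ locc _ _).
  apply/funext => a; apply: depP => j jN; rewrite /upd; case: eqP => // _.
  exact: vw.
have [k Kk] := uniform_finiteness oM dK depK fK.
have KP w z : ~ K w z -> locc (fun a => P (upd w n a)) z by move=> /contrapT.
clearbody K.
(* [S1] gives the number of boundary points below [w n], and [S2] then tells whether [w n] is one
   itself. [Q1] and [Q2] record the truth of [P] at the boundary point and on the open piece,
   respectively. *)
pose S1 t w := below t (K w) (w n).
pose S2 t w := exists a, a <= w n /\ K w a /\ below t (K w) a.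
pose Q1 t w := exists z, stage t (K w) z /\ K w z /\ P (upd w n z).
pose Q2 t w := exists z, stage t (K w) z /\ ~ K w z /\ P (upd w n z).
have dS1 t : dfn_mix n.+1 (S1 t).
  apply: dfn_mix_ray => //; first by rewrite /S1; solve_dfn.
  by move=> w a wa; rewrite /S1 Kn updE; apply: below_mono; exact: ltW.
have dS2 t : dfn_mix n.+1 (S2 t).
  apply: dfn_mix_ray => //; first by rewrite /S2; solve_dfn.
  move=> w a wa [b [bw H]]; exists b; rewrite Kn updE; split=> //.
  exact: le_trans bw (ltW wa).
have dQ1 t : dfn_mix n.+1 (Q1 t).
  apply: ind => [|w a]; first by rewrite /Q1; solve_dfn.
  by rewrite /Q1 Kn; congr (ex _); apply/funext => z; rewrite upd_upd.
have dQ2 t : dfn_mix n.+1 (Q2 t).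
  apply: ind => [|w a]; first by rewrite /Q2; solve_dfn.
  by rewrite /Q2 Kn; congr (ex _); apply/funext => z; rewrite upd_upd.
apply: (dfn_mix_iff (P := fun w => exists2 t, (t < k)%N &
    (S1 t w /\ ~ S1 t.+1 w) /\ ((S2 t w /\ Q1 t w) \/ (~ S2 t w /\ Q2 t w)))).
  move=> w; have KS t : stage t (K w) (w n) -> (K w (w n) <-> S2 t w).
    move=> [s1 s2]; split=> [Kw|[a [aw [Ka b]]]]; first by exists (w n).
    move: aw; rewrite le_eqVlt => /orP[/eqP<-//|aw].
    by case: s2; exists a.
  split=> [[t _ [st [[s2 [z [sz [Kz Pz]]]]|[ns2 [z [sz [nKz Pz]]]]]]]|Pw].
  - have Kw := (KS t st).2 s2.
    by move: Pz; rewrite (stage_inj sz st Kz Kw) upd_id.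
  - have nKw : ~ K w (w n) by move=> /(KS t st).
    by have := piece_const (KP w) (conj sz nKz) (conj st nKw); rewrite upd_id; tauto.
  have [t tk st] := stageP (Kk w (w n)); exists t => //; split=> //.
  have [Kw|nKw] := pselect (K w (w n)); [left|right]; split.
  - exact/KS.
  - by exists (w n); rewrite upd_id.
  - by move=> /(KS t st).
  - by exists (w n); rewrite upd_id.
apply: dfn_mix_exlt => t; apply: (dfn_mix_and (dfn_mix_and _ (dfn_mix_not _))) => //.
by apply: dfn_mix_or; apply: dfn_mix_and => //; exact: dfn_mix_not.
Qed.

End DefinableTypes.

(** * Compactness *)

Section Compactness.
Context {L : language} {R : realType} (M : expansion L R).

Definition ext m (b : 'rV[R]_m) (j : nat) : R :=
  if insub j is Some i then b 0 i else 0.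

Lemma ext_rowv m (b : 'rV[R]_m) : rowv m (ext b) = b.
Proof. by apply/rowP => i; rewrite mxE /ext valK. Qed.

Lemma rowv_cat n m (v u : nat -> R) :
  row_mx (rowv n v) (rowv m u) = rowv (n + m) (mix n v (fun j => u (j - n)%N)).
Proof.
apply/rowP => i; rewrite !mxE /mix; case: splitP => j ->; rewrite mxE //.
by rewrite addKn.
Qed.

Lemma dfn_exs (P : (nat -> R) -> Prop) (s : seq nat) : dfn M P ->
  dfn M (fun v => exists u, (forall j, j \notin s -> u j = v j) /\ P u).
Proof.
move=> dP; elim: s => [|i s IH].
  apply: dfn_iff dP => v; split=> [Pv|[u [uv]]]; first by exists v.
  by have -> : u = v by apply/funext => j; exact: uv.
pose Q v := exists u, (forall j, j \notin s -> u j = v j) /\ P u.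
have dQ : dfn M Q by [].
apply: (dfn_iff (P := fun v => exists a, Q (upd v i a))); last first.
  by clearbody Q; solve_dfn.
move=> v; split=> [[a [u [uv Pu]]]|[u [uv Pu]]].
  exists u; split=> // j; rewrite inE negb_or => /andP[ji js].
  by rewrite (uv j js) /upd (negbTE ji).
exists (u i), u; split=> // j js; rewrite /upd; case: eqP => [->//|/eqP ji].
by apply: uv; rewrite inE negb_or ji.
Qed.

(** Applied to a basis, it shows that the space [X], being the union of its basic sets, is
    definable. *)
Lemma definable_union_fiber n m (Phi : set 'rV[R]_(n + m)) (B : set 'rV[R]_m) :
  definable M Phi -> definable M B ->
  definable M [set x | exists2 b, B b & fiber Phi b x].
Proof.
move=> /definable_dfn dPhi /definable_dfn dB; apply/definable_dfn.
pose P u := B (rowv m (fun j => u (n + j)%N)) /\ Phi (rowv (n + m) u).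
have dP : dfn M P.
  apply: dfn_and => //.
  by apply: (dfn_sub (T := fun u j => u (n + j)%N) dB) => j; exact: coord_var.
apply: dfn_iff (dfn_exs (iota n m) dP) => v.
rewrite /fiber /=; split=> [[u [uv [Bu Pu]]]|[b Bb Pb]].
  exists (rowv m (fun j => u (n + j)%N)) => //=.
  rewrite rowv_cat; move: Pu; congr Phi; apply/rowP => i; rewrite !mxE /mix.
  case: ltnP => [ni|ni]; last by rewrite subnKC.
  by rewrite uv // mem_iota leqNgt ni.
move: Pb; rewrite -{1}(ext_rowv b) rowv_cat => Pb.
(* This is [v] with [b] written into the coordinates from [n] to n + m - 1. *)
pose u := mix n v (mix (n + m) (fun j => ext b (j - n)%N) v); exists u; split.
  move=> j; rewrite mem_iota negb_and -ltnNge -leqNgt /u /mix.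
  by case: ltnP => //= nj; rewrite ltnNge => ->.
split.
  rewrite (_ : rowv _ _ = b) //; rewrite -[RHS]ext_rowv.
  apply/rowP => i; rewrite !mxE /u /mix ltnNge leq_addr /=.
  by rewrite ltn_add2l ltn_ord addKn.
move: Pb; congr Phi; apply/rowP => i; rewrite !mxE /u /mix.
by rewrite ltn_ord.
Qed.

Lemma definable_fiber n m (Phi : set 'rV[R]_(n + m)) (b : 'rV[R]_m) :
  definable M Phi -> definable M (fiber Phi b).
Proof.
move=> /definable_dfn dPhi; apply/definable_dfn.
apply: (dfn_iff (P := fun v => Phi (rowv (n + m) (mix n v (fun j => ext b (j - n)%N))))).
  by move=> v; rewrite -rowv_cat ext_rowv.
apply: (dfn_sub (T := fun v => mix n v (fun j => ext b (j - n)%N)) dPhi) => j.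
by rewrite /mix; solve_coord.
Qed.

Hypothesis oM : o_minimal M.

Definition trace_type {T : Type} n (f : T -> 'rV[R]_n) (U : set_system T) :
  set (set 'rV[R]_n) := [set A | definable M A /\ U (f @^-1` A)].

(** Completeness comes from the ultrafilter, definability from [dfn_ultra]. *)
Theorem ultra_definable_type {T : Type} n (f : T -> 'rV[R]_n) (U : set_system T) :
  UltraFilter U -> definable_type M (trace_type f U).
Proof.
move=> uU; split.
  split.
  - by move=> A [].
  - by move=> [_ /filter_ex[]].
  - move=> A B [/definable_dfn dA UA] [/definable_dfn dB UB]; split.
      by apply/definable_dfn; exact: dfn_and.
    exact: filterI.
  - move=> A B dB AB [dA UA]; split=> //.
    by apply: filterS UA => t; exact: AB.
  - move=> A dA; have [UA|nUA] := pselect (U (f @^-1` A)); [by left|right]; split.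
      by apply/definable_dfn/dfn_not/definable_dfn.
    exact: (ultraN (fun t => A (f t))).2 nUA.
move=> m Phi dPhi.
apply/definable_dfn.
have /(dfn_ultra oM (U := U) (fun t => ext (f t)) n) := (definable_dfn M Phi).1 dPhi.
move=> /(@dfn_sub _ _ _ _ (fun v j => v (j - n)%N)) /(_ (fun j => coord_var _)).
apply: dfn_iff => v.
have E t : rowv (n + m) (mix n (ext (f t)) (fun j => v (j - n)%N)) =
    row_mx (f t) (rowv m v) by rewrite -rowv_cat ext_rowv.
split=> [H|[_ H]].
  split; first exact: definable_fiber.
  by apply: filterS H => t /=; rewrite E.
by apply: filterS H => t /=; rewrite E.
Qed.

Context {n : nat} {X : set 'rV[R]_n} (tau : Topological X).

Lemma compact_definably_compact :
  cover_compact [set: topspace tau] -> definably_compact M tau.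
Proof.
move=> cT p [[_ p0 pI _ _] _] pX; apply: contrapT => /forallNP nlim.
have /choice[C CP] a : exists C : set (topspace tau),
    [/\ closed C, p (val @` C) & ~ C a].
  have /existsNP[C /not_implyP[cC /not_implyP[pC nCa]]] := nlim a.
  by exists C.
have [|a _|s _ sT] := cT _ setT (fun a => ~` C a).
- by move=> a _; have [cC _ _] := CP a; exact: closed_openC.
- by exists a => //; have [_ _] := CP a.
(* Finite intersections of the sets [C c] belong to the type, starting from [X]; the finite subcover
   makes one of them empty. *)
pose I (s : seq (topspace tau)) := [set a | forall c, c \in s -> C c a].
have pIs (t : seq (topspace tau)) : p (val @` I t).
  elim: t => [|c t IH].
    rewrite (_ : val @` _ = X) //; apply/seteqP; split=> [_ [a _ <-]|x Xx].
      exact: set_valP.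
    by exists (SigSub (mem_set Xx)).
  have [_ pC _] := CP c; move: (pI _ _ IH pC); congr p.
  apply/seteqP; split=> [_ [[a Ia <-] [b Cb /val_inj ba]]|_ [a Ia <-]].
    exists a => // d; rewrite inE => /orP[/eqP->|]; last exact: Ia.
    by rewrite -ba.
  split; exists a => //; last by apply: Ia; rewrite mem_head.
  by move=> d dt; apply: Ia; rewrite inE dt orbT.
apply: p0; move: (pIs (enum_fset s)); congr p.
apply/seteqP; split=> // y [a Ia _]; exfalso.
by have [c /= cs] := sT a Logic.I; case; exact: Ia.
Qed.

(** Without a finite subcover the complements generate a proper filter. The limit of an ultrafilter
    extending it would lie in a member of the cover, whose complement is also in the ultrafilter. *)
Lemma cover_compact_ultra (T : topologicalType) :
  (forall U : set_system T, UltraFilter U -> exists a : T, U --> a) ->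
  cover_compact [set: T].
Proof.
move=> cvgU I D f fo Tf; apply: contrapT => nfin.
pose J := [set s : seq I | {subset s <= D}].
pose F (s : seq I) := [set x | forall i, i \in s -> ~ f i x].
have FF : ProperFilter (filter_from J F).
  apply: filter_from_proper.
    apply: filter_from_filter; first by exists [::].
    move=> s t Js Jt; exists (s ++ t).
      by move=> i; rewrite mem_cat => /orP[/Js|/Jt].
    by move=> x H; split=> i it; apply: H; rewrite mem_cat it ?orbT.
  move=> s Js; apply: contrapT => nE; apply: nfin.
  exists [fset i in s]%fset; first by move=> i; rewrite in_fset => /Js.
  move=> x _; apply: contrapT => nx; apply: nE; exists x => i si fix_.
  by apply: nx; exists i => //=; rewrite inE.
have [U [uU FU]] := ultraFilterLemma FF.
have [a Ua] := cvgU U uU.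
have [i Di fia] := Tf a Logic.I.
have Ufi : U (f i) by apply: Ua; apply: open_nbhs_nbhs; split=> //; exact: fo.
have Uc : U (~` f i).
  apply: FU; exists [:: i].
    by move=> j; rewrite inE => /eqP->; rewrite inE.
  by move=> x H; apply: H; rewrite mem_head.
by have [x []] := filter_ex (filterI Ufi Uc).
Qed.

Lemma definably_compact_compact : definable_topology M tau ->
  definably_compact M tau -> cover_compact [set: topspace tau].
Proof.
move=> [F [[m [Phi [B [dPhi dB _ FE]]]] FX [bo bF]]] dc.
have dX : definable M X.
  rewrite (_ : X = [set x | exists2 b, B b & fiber Phi b x]).
    exact: definable_union_fiber.
  apply/seteqP; split=> x; last first.
    by move=> [b Bb]; apply: FX; rewrite FE; exists b.
  move=> Xx; pose a : topspace tau := SigSub (mem_set Xx).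
  have [_ [[A FA <-] Aa] _] := bF a setT filterT.
  by move: FA; rewrite FE => -[b Bb bA]; exists b => //; rewrite bA.
apply: cover_compact_ultra => U uU.
have pX : trace_type (val : topspace tau -> _) U X.
  split=> //; apply: filterS (@filterT _ U _) => x _; exact: set_valP.
have [a aP] := dc _ (ultra_definable_type (val : topspace tau -> _) uU) pX.
exists a => N /bF[_ [[A FA <-] Aa] AN]; apply: filterS AN _.
(* If the basic neighbourhood [A] of [a] is not in [U], its complement in [X] is a closed set of the
   type, so the limit [a] would lie in it. *)
apply: contrapT => nUA.
have dA : definable M A by move: FA; rewrite FE => -[b _ <-]; exact: definable_fiber.
apply: (aP (~` (val @^-1` A))) => //.
  by apply: open_closedC; apply: bo; exists A.
have E : val @` (~` (val @^-1` A) : set (topspace tau)) = X `&` ~` A.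
  apply/seteqP; split=> [_ [x nAx <-]|x [Xx nAx]].
    by split=> //; exact: set_valP.
  by exists (SigSub (mem_set Xx)).
rewrite E; split.
  apply/definable_dfn; apply: dfn_and; first exact/definable_dfn.
  by apply: dfn_not; exact/definable_dfn.
have UA : U [set x : topspace tau | ~ A (val x)] by apply/(ultraN (U := U)).
by apply: filterS UA => x nAx; split=> //; exact: set_valP.
Qed.

End Compactness.

Theorem corollary5p19 (R : realType) (L : language) (M : expansion L R)
    (n : nat) (X : set 'rV[R]_n) (tau : Topological X) :
  o_minimal M -> definable_topology M tau ->
  (definably_compact M tau <-> cover_compact [set: topspace tau]).
Proof.
move=> oM dtau; split; first exact: definably_compact_compact.
exact: compact_definably_compact.
Qed.
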